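(* Let $\alpha\ge1$, $a>1$, $b\in\mathbb{R}$, and let $$h_\alpha(r)=\frac{e^{-\pi\alpha r}}{r}-b\,\frac{e^{-\pi a\alpha r}}{r},\qquad r>0.$$ If $b\le b_{c_0}:=\frac{1}{\sqrt a}$ (a value independent of $\alpha$), then the minimizer of $E_{h_\alpha}(L)$ among two-dimensional lattices $L$ of area $1$ exists and is always the hexagonal lattice.
   Context: For a potential $f:(0,\infty)\to\mathbb{R}$ and a two-dimensional lattice $L\subset\mathbb{R}^2$, $E_f(L)=\sum_{\mathbb{P}\in L\setminus\{0\}}f(|\mathbb{P}|^2)$, where $|\cdot|$ is the Euclidean norm. The hexagonal lattice of area $1$ is $\Lambda_1=\sqrt{\frac{2}{\sqrt3}}\,\big[\mathbb{Z}(1,0)\oplus\mathbb{Z}(\frac12,\frac{\sqrt3}{2})\big]$; lattices are identified up to isometry of $\mathbb{R}^2$. *)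

(* Defs.v *)
From HB Require Import structures.
From mathcomp Require Import all_boot all_order all_algebra.
From mathcomp Require Import all_classical all_reals all_analysis.

Set Implicit Arguments.
Unset Strict Implicit.
Unset Printing Implicit Defensive.

Import Order.TTheory GRing.Theory Num.Theory.

Local Open Scope classical_set_scope.
Local Open Scope ring_scope.

(* The library norm on row vectors is the sup norm, hence this definition. *)
Definition enorm (R : realType) (P : 'rV[R]_2) : R :=
  Num.sqrt (\sum_(j < 2) P 0 j ^+ 2).

Definition vec2 (R : realType) (x y : R) : 'rV[R]_2 :=
  \row_(j < 2) (if j == 0 then x else y).

Definition int_span (R : realType) (u v : 'rV[R]_2) : set 'rV[R]_2 :=
  [set P | exists m n : int, P = u *~ m + v *~ n].

Definition lattice_of_area (R : realType) (A : R) (L : set 'rV[R]_2) : Prop :=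
  exists u v : 'rV[R]_2,
    [/\ \det (col_mx u v) != 0, `|\det (col_mx u v)| = A & L = int_span u v].

Definition isometric (R : realType) (L L' : set 'rV[R]_2) : Prop :=
  exists T : 'rV[R]_2 -> 'rV[R]_2,
    (forall P Q, enorm (T P - T Q) = enorm (P - Q)) /\ T @` L = L'.

Definition hexagonal_lattice (R : realType) : set 'rV[R]_2 :=
  [set Num.sqrt (2 / Num.sqrt 3) *: P
     | P in int_span (vec2 1 0) (vec2 (1 / 2) (Num.sqrt 3 / 2))].

Arguments hexagonal_lattice R : clear implicits.

(* Sum over L \ {0}, as the difference of the sums of the positive and negative
   parts ([esum] is only meaningful for nonnegative families). It is the usual
   sum whenever the family is absolutely summable, as it is for exponentially
   decaying potentials; it is a junk value only if both parts sum to +oo. *)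
Definition lattice_energy (R : realType) (f : R -> R) (L : set 'rV[R]_2)
    : \bar R :=
  (\esum_(P in L `\ (0%R : 'rV[R]_2)) (Num.max (f (enorm P ^+ 2)) 0)%:E
   - \esum_(P in L `\ (0%R : 'rV[R]_2)) (Num.max (- f (enorm P ^+ 2)) 0)%:E)%E.

Definition energy_minimizer (R : realType) (f : R -> R) (A : R)
    (L : set 'rV[R]_2) : Prop :=
  lattice_of_area A L /\
  forall L', lattice_of_area A L' ->
    (lattice_energy f L <= lattice_energy f L')%E.

(* Only the values at r > 0 matter. *)
Definition yukawa_diff (R : realType) (alpha a b : R) (r : R) : R :=
  expR (- (pi * alpha * r)) / r - b * (expR (- (pi * a * alpha * r)) / r).

(* Main.v *)
Require Import Defs.
From mathcomp Require Import all_boot all_order all_algebra.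
From mathcomp Require Import all_classical all_reals all_analysis.
From mathcomp Require Import ring lra zify.

Set Implicit Arguments.
Unset Strict Implicit.
Unset Printing Implicit Defensive.

Import Order.TTheory GRing.Theory Num.Theory.
Import numFieldNormedType.Exports.

Local Open Scope classical_set_scope.
Local Open Scope ring_scope.

(** Write [|P|^2] for the squared length of a lattice vector and
    [X = exp (- 3 |P|^2)].  Since [b <= 1 / sqrt a < 1], the potential factors
    as [f r = exp (- 3 r) * g r] with [g] positive, decreasing and convex
    ([yukawa_factor_decreasing_convex]; here [3 <= pi <= pi * alpha]).  This
    makes [f r] a convex increasing function of [exp (- 3 r)], so at every
    [r0 > 0] it is bounded below by an affine function of [exp (- 3 r)] with
    positive slope, and the slopes decrease with [r0] ([exp_support],
    [exp_support_of_decreasing_convex]).  The proof therefore never has to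
    look at [f] again: it compares sums of the single exponential
    [exp (- 3 r)], weighted by the slopes at the distances of the hexagonal
    lattice, of which the slope at the shortest distance is the largest.

    A lattice of area 1 has an obtuse superbase, that is, vectors
    [u + v + w = 0] with [A = - u.v], [B = - v.w], [C = - w.u] nonnegative
    ([obtuse_basis_exists]).  In these Selling parameters
    [|i u + j v|^2 = A (i - j)^2 + B j^2 + C i^2], the area condition is
    [A B + B C + C A = 1], and the hexagonal lattice is
    [A = B = C = sqrt 3 / 3].  The excess [U = A + B + C - sqrt 3] is
    nonnegative and vanishes only for the hexagonal lattice.  What has to be
    shown is that the energy exceeds the hexagonal one by a positive multiple
    of [U / (2 sqrt 3 + 3 U)] ([selling_energy_gain]); uniqueness and the
    isometry are then elementary ([hexagonal_minimality]).

    The six shortest vectors have the squared lengths [A + B], [B + C],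
    [C + A], each twice.  Their exponentials gain over the hexagonal ones
    because the area condition forces the squares of the deviations of these
    lengths to add up to so much that the second order term of the exponential
    beats the first order loss caused by the growth of the mean
    ([three_exponentials]).

    For the remaining vectors the linear parts cancel when one averages over
    the rotation of order three of the hexagonal lattice, under which the
    three values of the form have mean [2 n (A + B + C) / 3] with [n] the
    Eisenstein norm ([selling_form_hexrot_sum]).  By convexity what is lost is
    at most [2 n exp (- 2 n sqrt 3) (1 - exp (- U))] times a slope per vector
    ([far_energy_loss]), and since [n >= 3] the sum of these losses is much
    smaller than the gain ([near_gain_exceeds_far_loss]). *)

(** * Convexity of the remainder of the exponential *)

Section exponential_bounds.
Variable R : realType.
Implicit Types l x y z t : R.

Lemma series_exp_coeffSS x n :
  series (exp_coeff x) n.+2 = 1 + x + \sum_(i < n) x ^+ i.+2 / i.+2`!%:R.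
Proof.
rewrite seriesEnat /= 2?big_nat_recl//= big_mkord.
by rewrite /exp_coeff /= expr0 expr1 fact0 !divr1 addrA.
Qed.

Lemma expR_ge_quadratic t : 0 <= t -> 1 + t + t ^+ 2 / 2 <= expR t.
Proof.
move=> t0; rewrite /expR; apply: limr_ge; first exact: is_cvg_series_exp_coeff.
exists 3%N => // n /= n3.
rewrite -(subnK n3) addn3 series_exp_coeffSS big_ord_recl /= addrA lerDl.
by apply: sumr_ge0 => i _; rewrite divr_ge0 ?exprn_ge0.
Qed.

Lemma expRN_le_quadratic t : 0 <= t -> expR (- t) <= 1 - t + t ^+ 2 / 2.
Proof.
move=> t0; rewrite expRN.
have q0 : 0 < 1 + t + t ^+ 2 / 2 by nra.
apply: (@le_trans _ _ (1 + t + t ^+ 2 / 2)^-1).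
  by rewrite lef_pV2 ?posrE ?expR_gt0// expR_ge_quadratic.
rewrite -[leLHS]div1r ler_pdivrMr//.
have -> : (1 - t + t ^+ 2 / 2) * (1 + t + t ^+ 2 / 2) = 1 + (t ^+ 2) ^+ 2 / 4.
  by field.
by rewrite lerDl divr_ge0 ?sqr_ge0.
Qed.

(** Termwise in the exponential series: [l ^+ k <= l ^+ 2] for [k >= 2]. *)
Lemma expR_remainder_scale l t : 0 <= t -> 0 <= l <= 1 ->
  expR (l * t) - 1 - l * t <= l ^+ 2 * (expR t - 1 - t).
Proof.
move=> t0 /andP[l0 l1].
suff : expR (l * t) - l ^+ 2 * expR t <= 1 + l * t - l ^+ 2 * (1 + t) by lra.
have cvgS x : series (exp_coeff x) @ \oo --> expR x.
  exact: is_cvg_series_exp_coeff.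
have lim_diff : series (exp_coeff (l * t)) n - l ^+ 2 * series (exp_coeff t) n
    @[n --> \oo] --> expR (l * t) - l ^+ 2 * expR t.
  by apply: cvgB; [exact: cvgS|apply: cvgMl_tmp; exact: cvgS].
apply: cvgr_to_le lim_diff _.
exists 2%N => // n /= n2.
rewrite -(subnK n2) addn2 !series_exp_coeffSS.
set S := \sum_(i < _) (l * t) ^+ _ / _; set T := \sum_(i < _) _.
suff : S <= l ^+ 2 * T by lra.
rewrite /S /T mulr_sumr.
apply: ler_sum => i _; rewrite exprMn -mulrA ler_wpM2r//.
  by rewrite divr_ge0 ?exprn_ge0.
by rewrite exprSr exprSr -mulrA -expr2 ler_piMl ?sqr_ge0// exprn_ile1.
Qed.

(** The function [(exp z - 1 - z) / z ^+ 2] is increasing on the whole line.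
    This is the convexity of [(1 - exp (- t)) / t], see
    [decreasing_convex_1BexpR]. *)
Lemma expR_remainder_ratio z t : 0 < t -> z <= t ->
  t ^+ 2 * (expR z - 1 - z) <= z ^+ 2 * (expR t - 1 - t).
Proof.
move=> t0 zt; have [z0|z0] := leP z 0.
  have h1 : expR z - 1 - z <= z ^+ 2 / 2.
    have := @expRN_le_quadratic (- z); rewrite opprK sqrrN => /(_ _); lra.
  have h2 : t ^+ 2 / 2 <= expR t - 1 - t.
    have := @expR_ge_quadratic t (ltW t0); lra.
  apply: (@le_trans _ _ (t ^+ 2 * (z ^+ 2 / 2))).
    by rewrite ler_wpM2l ?sqr_ge0.
  by rewrite mulrCA ler_wpM2l ?sqr_ge0.
have := @expR_remainder_scale (z / t) t (ltW t0).
rewrite divr_ge0 ?(ltW t0) ?(ltW z0)//= ler_pdivrMr// mul1r => /(_ zt).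
rewrite divfK ?gt_eqF// expr_div_n => h.
rewrite -(ler_pM2l (_ : 0 < (t ^+ 2)^-1)) ?invr_gt0 ?exprn_gt0//.
by rewrite mulrA mulVf ?mul1r ?gt_eqF ?exprn_gt0// mulrA [_^-1 * _]mulrC.
Qed.

End exponential_bounds.

(** * Decreasing convex functions on the half-line *)

Section decreasing_convex.
Variable R : realType.
Implicit Types f g : R -> R.

(** Convexity is expressed by supporting lines with slope [- s <= 0], which
    also makes [g] nonincreasing. *)
Definition decreasing_convex g := forall r0, 0 < r0 ->
  0 <= g r0 /\
  exists2 s, 0 <= s & forall r, 0 < r -> g r0 - s * (r - r0) <= g r.

Lemma decreasing_convex_le g r0 r1 : decreasing_convex g ->
  0 < r0 -> r0 <= r1 -> g r1 <= g r0.
Proof.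
move=> gP r00 r01; have [_ [s s0 /(_ _ r00)]] := gP _ (lt_le_trans r00 r01).
nra.
Qed.

Lemma decreasing_convexD f g : decreasing_convex f -> decreasing_convex g ->
  decreasing_convex (fun r => f r + g r).
Proof.
move=> fP gP r0 r00; have [f0 [s s0 sP]] := fP _ r00.
have [g0 [t t0 tP]] := gP _ r00; split; first exact: addr_ge0.
exists (s + t); first exact: addr_ge0.
by move=> r r_gt0; have := sP _ r_gt0; have := tP _ r_gt0; nra.
Qed.

Lemma decreasing_convexZ k g : 0 <= k -> decreasing_convex g ->
  decreasing_convex (fun r => k * g r).
Proof.
move=> k0 gP r0 r00; have [g0 [t t0 tP]] := gP _ r00; split.
  exact: mulr_ge0.
exists (k * t); first exact: mulr_ge0.
move=> r r_gt0; have := ler_wpM2l k0 (tP _ r_gt0); nra.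
Qed.

(** The product of the two increments is nonnegative because both functions
    are monotone in the same direction, so the product rule for the supporting
    lines only errs on the safe side. *)
Lemma decreasing_convexM f g : decreasing_convex f -> decreasing_convex g ->
  decreasing_convex (fun r => f r * g r).
Proof.
move=> fP gP r0 r00; have [f0 [s s0 sP]] := fP _ r00.
have [g0 [t t0 tP]] := gP _ r00; split; first exact: mulr_ge0.
exists (f r0 * t + g r0 * s); first by rewrite addr_ge0 ?mulr_ge0.
move=> r r_gt0; have sr := sP _ r_gt0; have tr := tP _ r_gt0.
have same_sign : 0 <= (f r - f r0) * (g r - g r0).
  have [rr0|r0r] := leP r r0.
    by apply: mulr_ge0; rewrite subr_ge0; exact: decreasing_convex_le.
  by apply: mulr_le0; rewrite subr_le0; apply: decreasing_convex_le => //;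
    exact: ltW.
have := ler_wpM2l f0 tr; have := ler_wpM2l g0 sr; nra.
Qed.

Lemma decreasing_convex_expR c : 0 <= c ->
  decreasing_convex (fun r => expR (- (c * r))).
Proof.
move=> c0 r0 r00; split; first exact: expR_ge0.
exists (c * expR (- (c * r0))); first by rewrite mulr_ge0 ?expR_ge0.
move=> r r_gt0; have -> : - (c * r) = - (c * (r - r0)) + - (c * r0) by ring.
rewrite expRD; have := expR_ge1Dx (- (c * (r - r0))).
have := expR_gt0 (- (c * r0)); nra.
Qed.

Lemma decreasing_convexV : decreasing_convex (fun r => r^-1).
Proof.
move=> r0 r00; split; first by rewrite invr_ge0 ltW.
exists (r0^-1 ^+ 2); first exact: sqr_ge0.
move=> r r_gt0; rewrite -(ler_pM2l (mulr_gt0 (mulr_gt0 r00 r00) r_gt0)).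
have -> : r0 * r0 * r * (r0^-1 - r0^-1 ^+ 2 * (r - r0)) = 2 * r0 * r - r ^+ 2.
  by field; rewrite gt_eqF.
have -> : r0 * r0 * r * r^-1 = r0 ^+ 2 by field; rewrite gt_eqF.
have := sqr_ge0 (r0 - r); nra.
Qed.

(** With [h = r - r0], the supporting line inequality, cleared of denominators,
    is [expR_remainder_ratio] for [z = - c * h] and [t = c * r0]. *)
Lemma decreasing_convex_1BexpR c : 0 < c ->
  decreasing_convex (fun r => (1 - expR (- (c * r))) / r).
Proof.
move=> c0 r0 r00; split.
  rewrite divr_ge0 ?(ltW r00)// subr_ge0 -expR0 ler_expR oppr_le0.
  by rewrite mulr_ge0// ltW.
have E0 := expR_gt0 (- (c * r0)).
exists ((1 - expR (- (c * r0)) * (1 + c * r0)) / r0 ^+ 2).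
  rewrite divr_ge0 ?sqr_ge0// subr_ge0.
  have := ler_wpM2l (ltW E0) (expR_ge1Dx (c * r0)).
  by rewrite -expRD addNr expR0.
move=> r r_gt0.
have cr0 : 0 < c * r0 by exact: mulr_gt0.
have zlt : - (c * (r - r0)) <= c * r0 by nra.
have h := ler_wpM2l (ltW E0) (expR_remainder_ratio cr0 zlt).
have -> : - (c * r) = - (c * (r - r0)) + - (c * r0) by ring.
rewrite expRD.
rewrite -(ler_pM2l (mulr_gt0 (mulr_gt0 r00 r00) r_gt0)).
set E := expR (- (c * r0)) in E0 h *; set F := expR (- (c * (r - r0))) in h *.
have EE : E * expR (c * r0) = 1 by rewrite /E -expRD addNr expR0.
have -> : r0 * r0 * r *
    ((1 - E) / r0 - (1 - E * (1 + c * r0)) / r0 ^+ 2 * (r - r0)) =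
    r * (r0 * (1 - E) - (1 - E * (1 + c * r0)) * (r - r0)).
  by field; rewrite gt_eqF.
have -> : r0 * r0 * r * ((1 - F * E) / r) = r0 ^+ 2 * (1 - F * E).
  by field; rewrite gt_eqF.
rewrite -(ler_pM2l (mulr_gt0 c0 c0)).
have h2 : (c * r0) ^+ 2 * (F * E - E + c * (r - r0) * E) <=
    (c * (r - r0)) ^+ 2 * (E * expR (c * r0) - E - c * r0 * E) by move: h; lra.
by move: h2; rewrite EE; lra.
Qed.

End decreasing_convex.

(** * Supporting lines in the variable exp (- 3 r) *)

Section support.
Variable R : realType.
Implicit Types f g : R -> R.

(** [k] is the slope at [r0] of a supporting line of [f] viewed as a function
    of [expR (- (3 * r))]. *)
Definition exp_support f r0 k := forall r, 0 < r ->
  f r0 + k * (expR (- (3 * r)) - expR (- (3 * r0))) <= f r.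

Lemma exp_support_antitone f r0 r1 k0 k1 : 0 < r0 -> r0 < r1 ->
  exp_support f r0 k0 -> exp_support f r1 k1 -> k1 <= k0.
Proof.
move=> r00 r01 /(_ r1 (lt_trans r00 r01)) h0 /(_ r0 r00) h1.
have : expR (- (3 * r1)) < expR (- (3 * r0)).
  by rewrite ltr_expR ltrN2 ltr_pM2l.
nra.
Qed.

(** The slope is that of the product rule, [g r0 + s / 3]; the claim reduces to
    [1 + t <= expR t] for [t = 3 * (r - r0)]. *)
Lemma exp_support_of_decreasing_convex f g r0 : decreasing_convex g ->
  (forall r, 0 < r -> f r = expR (- (3 * r)) * g r) -> 0 < r0 -> 0 < g r0 ->
  exists2 k, 0 < k & exp_support f r0 k.
Proof.
move=> gP fE r00 g0; have [_ [s s0 sP]] := gP _ r00.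
exists (g r0 + s / 3); first by rewrite ltr_wpDr// divr_ge0.
move=> r r_gt0; rewrite !fE//; set X := expR (- (3 * r)).
have XE : expR (- (3 * r0)) = X * expR (3 * (r - r0)).
  by rewrite /X -expRD; congr expR; ring.
have X0 : 0 < X := expR_gt0 _.
have h1 := ler_wpM2l (ltW X0) (sP _ r_gt0).
have h2 := ler_wpM2l (mulr_ge0 (ltW X0) s0) (expR_ge1Dx (3 * (r - r0))).
rewrite XE; move: h1 h2; set F := expR (3 * _); lra.
Qed.

End support.

(** * The bound pi >= 3 *)

Section pi_bound.
Variable R : realType.

Lemma sin_le (x : R) : 0 <= x -> sin x <= x.
Proof.
rewrite le_eqVlt => /predU1P[<-|x0]; first by rewrite sin0.
have [|y _] := @MVT R sin cos 0 x x0 (fun y _ => is_derive_sin y).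
  by apply: continuous_subspaceT => y; exact: continuous_sin.
by rewrite sin0 !subr0 => ->; rewrite ler_piMl ?cos_le1// ltW.
Qed.

(** The triple angle formula at [pi / 6] gives [sin (pi / 6) = 1 / 2], and
    [sin x <= x]. *)
Lemma pi_ge3 : 3 <= pi :> R.
Proof.
pose x : R := pi / 6.
have x0 : 0 < x by rewrite divr_gt0// pi_gt0.
have cx : 0 < cos x.
  by apply: cos_gt0_pihalf; move: x0; rewrite /x => x0; apply/andP; split; lra.
have : cos (x + (x + x)) = 0.
  by rewrite -[RHS](cos_pihalf R); congr cos; rewrite /x; lra.
rewrite !cosD sinD => triple.
have cs := cos2Dsin2 x.
have sx0 : 0 <= sin x.
  by apply: sin_ge0_pi; move: x0; rewrite /x => x0; apply/andP; split; lra.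
have s2 : sin x ^+ 2 = 1 - cos x ^+ 2 by lra.
have /eqP : cos x * (4 * cos x ^+ 2 - 3) = 0.
  transitivity (cos x ^+ 3 - 3 * cos x * sin x ^+ 2); first by rewrite s2; ring.
  by rewrite -[RHS]triple; ring.
rewrite mulf_eq0 gt_eqF//= => /eqP c2.
have := sin_le (ltW x0); rewrite {2}/x; nra.
Qed.

End pi_bound.

(** * The difference of Yukawa potentials *)

Section yukawa.
Variable R : realType.
Variables alpha a b : R.
Hypotheses (halpha : 1 <= alpha) (ha : 1 < a) (hb : b <= 1 / Num.sqrt a).
Let f := yukawa_diff alpha a b.
Let c := pi * alpha - 3.
Let d := pi * a * alpha - 3.
Let g r := expR (- (c * r)) / r - b * (expR (- (d * r)) / r).

Lemma yukawa_b_lt1 : b < 1.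
Proof.
apply: le_lt_trans hb _; rewrite div1r invf_lt1 ?sqrtr_gt0.
  by rewrite -[ltLHS]sqrtr1 ltr_sqrt// (lt_trans ltr01).
exact: lt_trans ha.
Qed.

Lemma yukawa_rates : 0 <= c < d.
Proof.
have p3 := pi_ge3 R; rewrite /c /d; apply/andP; split.
  by have := ler_wpM2l (pi_ge0 R) halpha; lra.
have : 0 < pi * alpha by rewrite mulr_gt0 ?pi_gt0// (lt_le_trans ltr01).
by move=> pa; have := pa; rewrite -(ltr_pM2r (_ : 0 < a - 1)) ?subr_gt0//; lra.
Qed.

Lemma yukawa_factor r : 0 < r -> f r = expR (- (3 * r)) * g r.
Proof.
move=> r0; rewrite /f /yukawa_diff /g.
have -> : - (pi * alpha * r) = - (3 * r) + - (c * r) by rewrite /c; ring.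
have -> : - (pi * a * alpha * r) = - (3 * r) + - (d * r) by rewrite /d; ring.
by rewrite !expRD; ring.
Qed.

Lemma yukawa_factor_gt0 r : 0 < r -> 0 < g r.
Proof.
move=> r0; rewrite /g mulrA -mulrBl divr_gt0// subr_gt0.
have /andP[c0 cd] := yukawa_rates.
have h : expR (- (d * r)) < expR (- (c * r)).
  by rewrite ltr_expR ltrN2 ltr_pM2r.
have := expR_gt0 (- (d * r)); have := yukawa_b_lt1; nra.
Qed.

(** For [b > 0] the negative term is compensated by splitting [1 = (1 - b) + b]:
    the numerator [exp (- c r) - b exp (- d r)] is [(1 - b) exp (- c r)] plus
    [b exp (- c r) (1 - exp (- (d - c) r))]. *)
Lemma yukawa_factor_decreasing_convex : decreasing_convex g.
Proof.
have /andP[c0 cd] := yukawa_rates.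
have eP e : 0 <= e -> decreasing_convex (fun r => expR (- (e * r)) / r).
  move=> e0; apply: decreasing_convexM; first exact: decreasing_convex_expR.
  exact: decreasing_convexV.
have [b0|b0] := leP b 0.
  have -> : g = (fun r => expR (- (c * r)) / r + - b * (expR (- (d * r)) / r)).
    by apply/funext => r; rewrite /g mulNr.
  apply: decreasing_convexD; first exact: eP.
  apply: decreasing_convexZ; first by rewrite oppr_ge0.
  exact/eP/ltW/(le_lt_trans c0).
have -> : g = (fun r => (1 - b) * (expR (- (c * r)) / r) +
    b * (expR (- (c * r)) * ((1 - expR (- ((d - c) * r))) / r))).
  apply/funext => r; rewrite /g !mulrA.
  have -> : - (d * r) = - (c * r) + - ((d - c) * r) by ring.
  by rewrite expRD; ring.
apply: decreasing_convexD.
  apply: decreasing_convexZ; last exact: eP.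
  by rewrite subr_ge0 ltW// yukawa_b_lt1.
apply: decreasing_convexZ; first exact: ltW.
apply: decreasing_convexM; first exact: decreasing_convex_expR.
by apply: decreasing_convex_1BexpR; rewrite subr_gt0.
Qed.

Lemma yukawa_exp_support r0 : 0 < r0 ->
  exists2 k, 0 < k & exp_support f r0 k.
Proof.
move=> r00; apply: (@exp_support_of_decreasing_convex _ _ g) => //.
- exact: yukawa_factor_decreasing_convex.
- exact: yukawa_factor.
- exact: yukawa_factor_gt0.
Qed.

Lemma yukawa_gt0 r : 0 < r -> 0 < f r.
Proof.
by move=> r0; rewrite yukawa_factor// mulr_gt0 ?expR_gt0// yukawa_factor_gt0.
Qed.

Lemma yukawa_le_exp r0 r : 0 < r0 -> r0 <= r ->
  f r <= g r0 * expR (- (3 * r)).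
Proof.
move=> r00 r0r; rewrite yukawa_factor ?(lt_le_trans r00)// mulrC.
rewrite ler_wpM2r ?expR_ge0//; apply: decreasing_convex_le => //.
exact: yukawa_factor_decreasing_convex.
Qed.

End yukawa.

(** * Three exponentials with prescribed sum and sum of squares *)

Section three_exponentials.
Variable R : realType.
Implicit Types e y w u T E : R.

Let s3 : R := Num.sqrt 3.

Lemma sqrt3_bounds : 433 / 250 <= s3 <= 97 / 56.
Proof.
have s0 : 0 <= s3 by exact: sqrtr_ge0.
have s2 : s3 ^+ 2 = 3 by rewrite sqr_sqrtr; lra.
by apply/andP; split; nra.
Qed.

Lemma sqr_sqrt3 : s3 ^+ 2 = 3.
Proof. by rewrite sqr_sqrtr. Qed.

Lemma expRN_ge_pow n y : y <= n.+1%:R ->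
  (1 - y / n.+1%:R) ^+ n.+1 <= expR (- y).
Proof.
move=> yn; have -> : - y = n.+1%:R * - (y / n.+1%:R).
  by rewrite mulrN mulrC divfK ?pnatr_eq0.
rewrite expRM_natl lerXn2r ?nnegrE ?expR_ge0//; last exact: expR_ge1Dx.
by rewrite subr_ge0 ler_pdivrMr// mul1r.
Qed.

Lemma expRN_ge_tangent y1 y e : 0 <= e -> e <= expR (- y1) -> y <= y1 + 1 ->
  e * (1 + y1 - y) <= expR (- y).
Proof.
move=> e0 he yy1; have -> : expR (- y) = expR (- y1) * expR (y1 - y).
  by rewrite -expRD addrA addNr add0r.
apply: (@le_trans _ _ (expR (- y1) * (1 + y1 - y))).
  by apply: ler_wpM2r; lra.
by rewrite ler_wpM2l ?expR_ge0// -addrA expR_ge1Dx.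
Qed.

Lemma expRN1_ge : 1 / 3 <= expR (- 1) :> R.
Proof. apply: le_trans (@expRN_ge_pow 7 _ _); lra. Qed.

Lemma expRN2_ge : 1 / 8 <= expR (- 2) :> R.
Proof. apply: le_trans (@expRN_ge_pow 31 _ _); lra. Qed.

Lemma quadratic_correction_le w0 w y T : 0 < w0 -> w0 <= w ->
  y ^+ 2 * (1 + 1 / (5 * w0)) <= w * T ->
  y ^+ 2 / w + y ^+ 2 / (5 * w ^+ 2) <= T.
Proof.
move=> w00 w0w h; have w_gt0 := lt_le_trans w00 w0w.
have -> : y ^+ 2 / w + y ^+ 2 / (5 * w ^+ 2) = y ^+ 2 * (1 + 1 / (5 * w)) / w.
  by field; rewrite gt_eqF.
rewrite ler_pdivrMr// [T * _]mulrC; apply: le_trans h.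
rewrite ler_wpM2l ?sqr_ge0// lerD2l !div1r lef_pV2 ?posrE ?mulr_gt0//.
by rewrite ler_pM2l.
Qed.

(** In the application [w = 2 * sqrt 3 + 3 * u] where [6 * u] is the sum of
    three numbers [y], and [6 * u * w] is the sum of their squares: summing
    this quadratic lower bound cancels the linear terms and leaves a gain from
    the last term alone. It would fail for [y] large compared with [w], which
    is what the hypotheses exclude. On successive intervals [expR (- y)] is
    replaced by [(1 - y / 4) ^+ 4], by tangents at 1 and at 2, and by 0, and
    [w] by a lower bound that the hypotheses give on the interval. *)
Lemma expRN_ge_corrected_quadratic y w : 2 * s3 <= w -> y + s3 <= w ->
  (0 <= y -> 3 / 4 * y ^+ 2 <= (w - 2 * s3) * (2 * s3 + y)) ->
  1 - y + y ^+ 2 / w + y ^+ 2 / (5 * w ^+ 2) <= expR (- y).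
Proof.
move=> w2 wy wq; have /andP[s3l s3u] := sqrt3_bounds.
rewrite -[leLHS]addrA -lerBrDl.
have corr w0 T E : 0 < w0 -> w0 <= w -> 1 - y + T <= E ->
    y ^+ 2 * (1 + 1 / (5 * w0)) <= w * T ->
    y ^+ 2 / w + y ^+ 2 / (5 * w ^+ 2) <= E - (1 - y).
  move=> w00 w0w TE /(quadratic_correction_le w00 w0w) h; lra.
(* 433 / 125 is a lower bound of [2 * sqrt 3], and 153 / 500 lies between the
   two coefficients of [y ^+ 2] that are compared: 3 / 8 - 1 / 16 + 1 / 256
   for the fourth power at [y = 1], and that of the claim at
   [w = 2 * sqrt 3]. *)
have [y1|y1] := leP y 1.
  apply: (@corr (433 / 125) (153 / 500 * y ^+ 2)); [lra|lra| |].
  - apply: le_trans (@expRN_ge_pow 3 y _); last lra.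
    have -> : (1 - y / 4) ^+ 4 = 1 - y + 153 / 500 * y ^+ 2 +
      y ^+ 2 * (69 / 1000 - y / 16 + y ^+ 2 / 256) by field.
    by rewrite lerDl; apply: mulr_ge0; have := sqr_ge0 y; lra.
  - have w433 : 433 / 125 <= w by lra.
    by have := ler_wpM2r (sqr_ge0 y) w433; have := sqr_ge0 y; lra.
have y0 : 0 < y := lt_trans ltr01 y1.
have {}wq := wq (ltW y0).
have sy0 : 0 < 2 * s3 + y by lra.
have w_lower T : T * (2 * s3 + y) <= 3 / 4 * y ^+ 2 -> T <= w - 2 * s3.
  by move=> /le_trans/(_ wq); rewrite (ler_pM2r sy0).
(* The tangent at 1 gives [1 - y + (2 * y - 1) / 3 = (2 - y) / 3]. *)
have [y2|y2] := leP y (3 / 2).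
  have w363 : 363 / 100 <= w.
    suff : 166 / 1000 <= w - 2 * s3 by lra.
    by apply: w_lower; have := sqr_ge0 (y - 1); lra.
  apply: (@corr (363 / 100) ((2 * y - 1) / 3)); [lra|exact: w363| |].
  - apply: le_trans (@expRN_ge_tangent 1 y _ _ expRN1_ge _); lra.
  - have sq : 0 <= (y - 1) * (3 / 2 - y) by apply: mulr_ge0; lra.
    apply: (@le_trans _ _ (363 / 100 * ((2 * y - 1) / 3))); first lra.
    by apply: ler_wpM2r; lra.
(* From 3 on, [y + sqrt 3] is a good enough lower bound for [w]. *)
have [y3|y3] := leP y 3; last first.
  apply: (@corr (y + s3) (y - 1)); [lra|lra| |].
  - by have := expR_ge0 (- y); lra.
  - have ys0 : 0 < 5 * (y + s3) by lra.
    have -> : y ^+ 2 * (1 + 1 / (5 * (y + s3))) =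
      y ^+ 2 * (5 * (y + s3) + 1) / (5 * (y + s3)) by field; lra.
    rewrite ler_pdivrMr; last exact: ys0.
    apply: (@le_trans _ _ ((y + s3) * (y - 1) * (5 * (y + s3)))); last first.
      by apply: ler_wpM2r (ltW ys0) _ _ _; apply: ler_wpM2r; lra.
    suff : y ^+ 2 <= 5 * (y + s3) * (s3 * (y - 1) - y) by lra.
    apply: (@le_trans _ _ (5 * (y + 433 / 250) * (433 / 250 * (y - 1) - y))).
      have yy : 0 <= (y - 3) * (y - 3) by apply: mulr_ge0; lra.
      by lra.
    apply: ler_pM; [lra|lra|lra|].
    by rewrite lerD2r; apply: ler_wpM2r; lra.
(* The tangent at 2 gives [1 - y + (7 * y - 5) / 8 = (3 - y) / 8]; the two lower
   bounds for [w] cross near [y = 5 / 2]. *)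
have t2 := @expRN_ge_tangent 2 y (1 / 8) _ expRN2_ge _.
have [y4|y4] := leP y (5 / 2).
  have w375 : 15 / 4 <= w.
    suff : 286 / 1000 <= w - 2 * s3 by lra.
    by apply: w_lower; have := sqr_ge0 (y - 3 / 2); lra.
  apply: (@corr (15 / 4) ((7 * y - 5) / 8)); [lra|exact: w375| |].
  - apply: le_trans (t2 _ _); lra.
  - rewrite -(ler_pM2r sy0).
    apply: (@le_trans _ _
      ((12 + 2 * s3 * y + 3 / 4 * y ^+ 2) * ((7 * y - 5) / 8))); last first.
      rewrite [leRHS]mulrAC; apply: ler_wpM2r; first lra.
      by move: wq; have := sqr_sqrt3; lra.
    have sq : 0 <= (y - 3 / 2) * (5 / 2 - y) by apply: mulr_ge0; lra.
    have cube : 0 <= y * ((y - 3 / 2) * (5 / 2 - y)).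
      by apply: mulr_ge0; [exact: ltW|exact: sq].
    have sy : s3 * y <= 97 / 56 * y by apply: ler_wpM2r; lra.
    have syy : s3 * y ^+ 2 <= 97 / 56 * y ^+ 2.
      by apply: ler_wpM2r; [exact: sqr_ge0|exact: s3u].
    lra.
apply: (@corr (423 / 100) ((7 * y - 5) / 8)); [lra|lra| |].
- apply: le_trans (t2 _ _); lra.
- have sq : 0 <= (y - 5 / 2) * (3 - y) by apply: mulr_ge0; lra.
  apply: (@le_trans _ _ ((y + 433 / 250) * ((7 * y - 5) / 8))); first lra.
  by apply: ler_wpM2r; lra.
Qed.

(** The three numbers are three times the deviations of the squared lengths of a
    superbase from the hexagonal ones, see [near_energy_gain]. *)
Lemma three_exponentials y1 y2 y3 u : 0 <= u ->
  y1 + y2 + y3 = 6 * u ->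
  y1 ^+ 2 + y2 ^+ 2 + y3 ^+ 2 = 6 * u * (2 * s3 + 3 * u) ->
  y1 <= s3 + 3 * u -> y2 <= s3 + 3 * u -> y3 <= s3 + 3 * u ->
  3 + 6 / 5 * (u / (2 * s3 + 3 * u)) <= expR (- y1) + expR (- y2) + expR (- y3).
Proof.
move=> u0 sum1 sum2 h1 h2 h3; have /andP[s3l s3u] := sqrt3_bounds.
set w := 2 * s3 + 3 * u in sum2 *.
have w0 : 0 < w by rewrite /w; lra.
have bound y y' y'' : y + y' + y'' = 6 * u ->
    y ^+ 2 + y' ^+ 2 + y'' ^+ 2 = 6 * u * w -> y <= s3 + 3 * u ->
    1 - y + y ^+ 2 / w + y ^+ 2 / (5 * w ^+ 2) <= expR (- y).
  move=> s1 s2 yle.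
  apply: expRN_ge_corrected_quadratic; rewrite ?/w; [lra|lra|].
  (* Cauchy-Schwarz for the other two numbers bounds [y ^+ 2] *)
  move=> _; have := sqr_ge0 (y' - y''); move: s2; rewrite /w.
  have -> : y'' = 6 * u - y - y' by lra.
  lra.
have := bound _ _ _ sum1 sum2 h1.
have := bound y2 y3 y1 ltac:(lra) ltac:(lra) h2.
have := bound y3 y1 y2 ltac:(lra) ltac:(lra) h3.
suff : y1 ^+ 2 / w + y2 ^+ 2 / w + y3 ^+ 2 / w = 6 * u /\
   y1 ^+ 2 / (5 * w ^+ 2) + y2 ^+ 2 / (5 * w ^+ 2) + y3 ^+ 2 / (5 * w ^+ 2)
   = 6 / 5 * (u / w) by lra.
by rewrite -!mulrDl sum2; split; field; rewrite gt_eqF.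
Qed.

Lemma expRN_2sqrt3_le : expR (- (2 * s3)) <= (10 / 53) ^+ 2.
Proof.
have /andP[s3l s3u] := sqrt3_bounds.
have h : 53 / 10 <= expR s3.
  have e32 : (1 + s3 / 32) ^+ 32 <= expR s3.
    have {2}-> : s3 = 32%:R * (s3 / 32) by field.
    by rewrite expRM_natl lerXn2r ?nnegrE ?expR_ge0 ?expR_ge1Dx//; lra.
  apply: le_trans e32.
  (* five successive squarings of [1 + sqrt 3 / 32] with rounding *)
  have p2 (x c d : R) n :
      0 <= c -> c <= x ^+ n -> d <= c ^+ 2 -> d <= x ^+ (n * 2).
    move=> c0 cx; rewrite exprM => /le_trans; apply.
    by rewrite lerXn2r ?nnegrE ?(le_trans c0 cx).
  apply: (p2 _ (231 / 100) _ 16); [lra| |lra].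
  apply: (p2 _ (38 / 25) _ 8); [lra| |lra].
  apply: (p2 _ (37 / 30) _ 4); [lra| |lra].
  apply: (p2 _ (311 / 280) _ 2); [lra| |lra].
  by apply: (p2 _ (527 / 500) _ 1); rewrite ?expr1; lra.
have -> : - (2 * s3) = 2%:R * - s3 by ring.
have E0 := expR_gt0 s3.
have inv : (expR s3)^-1 <= 10 / 53.
  by rewrite -[leLHS]div1r ler_pdivrMr; [lra|exact: E0].
have inv0 : 0 <= (expR s3)^-1 by rewrite invr_ge0 expR_ge0.
by rewrite expRM_natl expRN !expr2; apply: ler_pM.
Qed.

(** The right side is the gain of the six shortest vectors, the first term on
    the left the total loss of all others: [264 = 48 * (11 / 2)] combines the
    constant of [far_energy_loss] with the sum of [esum_halves_far].  The part
    of the gain that is left over is what makes the hexagonal lattice the only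
    minimizer. *)
Lemma near_gain_exceeds_far_loss u : 0 <= u ->
  264 * expR (- (2 * s3)) ^+ 3 * (1 - expR (- u)) +
    expR (- (2 * s3)) * (1 / 5 * (u / (2 * s3 + 3 * u))) <=
  2 * expR (- (2 * s3)) * (6 / 5 * (u / (2 * s3 + 3 * u))).
Proof.
move=> u0; have /andP[s3l s3u] := sqrt3_bounds.
have q0 := expR_gt0 (- (2 * s3)); have qle := expRN_2sqrt3_le.
set q := expR _ in q0 qle *; set w := 2 * s3 + 3 * u.
have w0 : 0 < w by rewrite /w; lra.
(* [1 - exp (- u)] is at most [u] and at most 1; weighted with [2 * sqrt 3]
   and 3 these two bounds add up to a multiple of [u / w]. *)
have saturate : 1 - expR (- u) <= (2 * s3 + 3) * (u / w).
  rewrite mulrA ler_pdivlMr// /w.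
  have := expR_gt0 (- u); have := expR_ge1Dx (- u); nra.
have uw0 : 0 <= u / w by rewrite divr_ge0// ltW.
have q2 : q ^+ 2 <= ((10 / 53) ^+ 2) ^+ 2.
  by rewrite [q ^+ 2]expr2 [leRHS]expr2; apply: ler_pM => //; exact: ltW.
have h : 264 * q ^+ 2 * (1 - expR (- u)) <= 11 / 5 * (u / w).
  apply: (@le_trans _ _ (264 * q ^+ 2 * ((2 * s3 + 3) * (u / w)))).
    by apply: ler_wpM2l saturate; apply: mulr_ge0 (sqr_ge0 _); lra.
  rewrite mulrA; apply: ler_wpM2r; first exact: uw0.
  apply: (@le_trans _ _ (264 * ((10 / 53) ^+ 2) ^+ 2 * (2 * s3 + 3))); last lra.
  apply: ler_wpM2r; first lra.
  by apply: ler_wpM2l; [lra|exact: q2].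
have := ler_wpM2l (ltW q0) h; lra.
Qed.

End three_exponentials.

(** * Geometric sums over the integer plane *)

Section geometric_sum.
Variable R : realType.

Lemma le_esumZl (T : choiceType) (D : set T) (k : R) (a : T -> R) : 0 <= k ->
  (forall i, 0 <= a i) ->
  (\esum_(i in D) (k * a i)%:E <= k%:E * \esum_(i in D) (a i)%:E)%E.
Proof.
move=> k0 a0; apply: ge_ereal_sup => _ [X [finX XD] <-].
under eq_fsbigr do rewrite EFinM.
rewrite -ge0_mule_fsumr; last by move=> i; rewrite lee_fin.
apply: lee_wpmul2l; first by rewrite lee_fin.
by apply: ereal_sup_ubound; exists X.
Qed.

Let half : R := 1 / 2.
Let half_pow_ge0 n : (0 <= (half ^+ n)%:E)%E.
Proof. by rewrite lee_fin exprn_ge0// divr_ge0. Qed.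

Lemma esum_halves_nat m :
  \esum_(n in [set: nat]) (half ^+ (n + m))%:E = (2 * half ^+ m)%:E.
Proof.
rewrite -nneseries_esumT; last by move=> n.
have := @cvg_geometric_eseries_half R (2 * half ^+ m) 0.
rewrite expr0 divr1 => /cvg_lim <- //; apply/congr_lim/funext => n.
rewrite /eseries /=; apply: eq_bigr => i _ /=; congr EFin.
rewrite natrX addn1 exprS exprD [half ^+ i]expr_div_n expr1n.
by field; rewrite expf_neq0.
Qed.

Lemma esum_halves_int :
  \esum_(n in [set: int]) (half ^+ `|n|%N)%:E = 3%:E.
Proof.
rewrite (esumID (range Posz))// !setTI.
have -> : ~` range Posz = range Negz.
  apply/seteqP; split => [[n|n]|_ [n _ <-] [m _]]//=; last by exists n.
  by case; exists n.
rewrite !esum_image; [|by move=> ? ? _ _ []|by move=> ? ? _ _ []].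
have := esum_halves_nat 0; under eq_esum do rewrite addn0.
move=> /= ->; have := esum_halves_nat 1; under eq_esum do rewrite addn1.
by move=> /= ->; rewrite -EFinD; congr EFin; rewrite /half; lra.
Qed.

Definition taxicab (P : int * int) : nat := (`|P.1| + `|P.2|)%N.

Lemma esum_halves_taxicab :
  (\esum_(P in [set: int * int]) (half ^+ taxicab P)%:E <= 9%:E)%E.
Proof.
have -> : [set: int * int] = [set: int] `*`` (fun=> [set: int]).
  by apply/seteqP; split.
under eq_esum do rewrite exprD.
rewrite -(@esum_esum _ _ _ _ _
  (fun i j : int => (half ^+ `|i|%N * half ^+ `|j|%N)%:E)); last first.
  by move=> i j _ _; rewrite EFinM mule_ge0.
have -> : 9%:E =
    (3%:E * \esum_(n in [set: int]) (half ^+ `|n|%N)%:E)%E :> \bar R.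
  by rewrite esum_halves_int -EFinM -natrM.
apply: le_trans (le_esumZl _ _ _); last 2 first.
  by [].
  by move=> n; rewrite -lee_fin.
apply: le_esum => i _; apply: le_trans (le_esumZl _ _ _) _; last 1 first.
  by rewrite esum_halves_int -EFinM mulrC.
  by rewrite -lee_fin.
by move=> n; rewrite -lee_fin.
Qed.

Lemma esum_seq (T : choiceType) (r : seq T) (a : T -> \bar R) : uniq r ->
  (forall i, i \in r -> 0 <= a i)%E ->
  \esum_(i in [set` r]) a i = (\sum_(i <- r) a i)%E.
Proof.
move=> ur a0; rewrite fsbig_seq//= esum_fset// => i.
by rewrite inE => /a0.
Qed.

(** The coordinates of the six shortest vectors of the hexagonal lattice in an
    obtuse basis. *)
Definition near_vectors : seq (int * int) :=
  [:: (1, 0); (-1, 0); (0, 1); (0, -1); (1, 1); (-1, -1)].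

Definition far : set (int * int) := [set P | P != 0 /\ P \notin near_vectors].

(** The origin contributes 1 to the full sum 9, and the near vectors 5 / 2. *)
Lemma esum_halves_far :
  (\esum_(P in far) (half ^+ taxicab P)%:E <= (11 / 2)%:E)%E.
Proof.
have := esum_halves_taxicab.
rewrite (esumID [set` (0 : int * int) :: near_vectors])//.
rewrite setTI esum_seq// setTI.
have -> : ~` [set` (0 : int * int) :: near_vectors] = far.
  apply/seteqP; split => P /=.
    by move/negP; rewrite in_cons negb_or => /andP.
  by case=> P0 Pn; apply/negP; rewrite in_cons negb_or P0.
have -> : (\sum_(P <- (0%R : int * int) :: near_vectors) (half ^+ taxicab P)%:E
    = (7 / 2)%:E)%E.
  rewrite sumEFin !big_cons big_nil /taxicab /= !expr1 expr0 expr2; congr EFin.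
  by rewrite /half; lra.
rewrite -leeBrDl// -EFinB => /le_trans; apply; rewrite lee_fin; lra.
Qed.

End geometric_sum.

(** * The Eisenstein norm and the rotation of order three *)

Section hexagonal_index_form.
Implicit Types P : int * int.

(** Half the squared length in the hexagonal lattice scaled to minimal squared
    length 2. *)
Definition eisenstein_norm P : nat :=
  absz (P.1 ^+ 2 - P.1 * P.2 + P.2 ^+ 2).

Lemma eisenstein_normE P :
  (eisenstein_norm P)%:Z = P.1 ^+ 2 - P.1 * P.2 + P.2 ^+ 2.
Proof.
rewrite /eisenstein_norm gez0_abs//.
case: P => i j /=; have := sqr_ge0 (i - j); have := sqr_ge0 i.
have := sqr_ge0 j; nia.
Qed.

Lemma taxicab_le_2eisenstein_norm P : (taxicab P <= 2 * eisenstein_norm P)%N.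
Proof.
have := eisenstein_normE P; case: P => i j /=; rewrite /taxicab /=.
set n := eisenstein_norm _.
have hi : (`|i|%N)%:Z <= i ^+ 2 by nia.
have hj : (`|j|%N)%:Z <= j ^+ 2 by nia.
have := sqr_ge0 (i - j); nia.
Qed.

Lemma eisenstein_norm_gt0 P : P != 0 -> (0 < eisenstein_norm P)%N.
Proof.
move=> P0; have := taxicab_le_2eisenstein_norm P.
have : (0 < taxicab P)%N.
  by move: P0; case: P => i j; rewrite /taxicab xpair_eqE /=; lia.
lia.
Qed.

(** Twice the Eisenstein norm is [i ^+ 2 + j ^+ 2 + (i - j) ^+ 2], and
    [k ^+ 2 >= 2 * |k|] unless [|k| = 1]; the exceptional coordinates are
    checked by hand. *)
Lemma taxicab_le_eisenstein_norm_far P :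
  far P -> (taxicab P <= eisenstein_norm P)%N.
Proof.
case=> P0 Pn; have := eisenstein_normE P; move: P0 Pn.
case: P => i j; rewrite /near_vectors !inE !xpair_eqE /taxicab /=.
set n := eisenstein_norm _ => ij0 ij nE.
have small (k : int) : k = 1 \/ k = - 1 \/ (`|k|%N)%:Z * 2 <= k ^+ 2.
  have [|k2] := leP (`|k|%N)%:Z 1; first by lia.
  by right; right; nia.
have [i1|[i1|i2]] := small i.
- have : j <= -1 \/ j = 0 \/ j = 1 \/ 2 <= j by lia.
  by rewrite i1 in nE ij0 ij *; case=> [|[|[|]]] hj; nia.
- have : j <= -2 \/ j = -1 \/ j = 0 \/ 1 <= j by lia.
  by rewrite i1 in nE ij0 ij *; case=> [|[|[|]]] hj; nia.
have [j1|[j1|j2]] := small j.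
- have : i <= -1 \/ i = 0 \/ i = 1 \/ 2 <= i by lia.
  by rewrite j1 in nE ij0 ij *; case=> [|[|[|]]] hj; nia.
- have : i <= -2 \/ i = -1 \/ i = 0 \/ 1 <= i by lia.
  by rewrite j1 in nE ij0 ij *; case=> [|[|[|]]] hj; nia.
have nE2 : 2 * n%:Z = i ^+ 2 + j ^+ 2 + (i - j) ^+ 2 by rewrite nE; ring.
move: i2 j2 nE2 (sqr_ge0 (i - j)).
move: (i ^+ 2) (j ^+ 2) ((i - j) ^+ 2) => *; lia.
Qed.

Lemma eisenstein_norm_far_ge3 P : far P -> (3 <= eisenstein_norm P)%N.
Proof.
move=> Pfar; have := taxicab_le_eisenstein_norm_far Pfar; case: Pfar => P0 Pn.
have [|wt2 _] := leqP 3 (taxicab P); first by lia.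
have := eisenstein_normE P; move: P0 Pn wt2.
case: P => i j; rewrite /near_vectors !inE !xpair_eqE /taxicab /=.
set n := eisenstein_norm _ => ij0 ij wt2 nE.
have iE : i = -2 \/ i = -1 \/ i = 0 \/ i = 1 \/ i = 2 by lia.
have jE : j = -2 \/ j = -1 \/ j = 0 \/ j = 1 \/ j = 2 by lia.
by case: iE => [|[|[|[|]]]] iE; case: jE => [|[|[|[|]]]] jE;
  rewrite iE jE in nE ij0 ij wt2; lia.
Qed.

(** Rotation by a third of a turn: it permutes cyclically the three differences
    [i - j], [j], [- i], which have sum zero. *)
Definition hexrot P : int * int := (P.2 - P.1, - P.1).

Lemma hexrot_far P : far P -> far (hexrot P).
Proof.
case=> P0 Pn; split; move: P0 Pn; case: P => i j;
  rewrite /hexrot /near_vectors !inE !xpair_eqE /=; lia.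
Qed.

Lemma hexrot3 P : hexrot (hexrot (hexrot P)) = P.
Proof. by case: P => i j; rewrite /hexrot /=; congr pair; lia. Qed.

Lemma hexrot_bij : set_bij far far hexrot.
Proof.
split => [P|P Q _ _ PQ|P Pfar]; first exact: hexrot_far.
  by rewrite -[P]hexrot3 PQ hexrot3.
by exists (hexrot (hexrot P)); [exact/hexrot_far/hexrot_far|exact: hexrot3].
Qed.

End hexagonal_index_form.

(** * Binary forms in Selling parameters *)

Section selling_form.
Variable R : realType.
Implicit Types (A B C : R) (P : int * int).

(** The squared length of [i u + j v] when [A = - u.v], [B = - v.w] and
    [C = - w.u] for [w = - u - v], see [dot_combo]. *)
Definition selling_form A B C P : R :=
  A * ((P.1 - P.2)%:~R) ^+ 2 + B * (P.2%:~R) ^+ 2 + C * (P.1%:~R) ^+ 2.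

Lemma eisenstein_norm_natr P :
  (eisenstein_norm P)%:R =
    (P.1%:~R) ^+ 2 - P.1%:~R * P.2%:~R + (P.2%:~R) ^+ 2 :> R.
Proof.
rewrite -[LHS]/((eisenstein_norm P)%:Z%:~R) eisenstein_normE.
by rewrite !(rmorphB, rmorphD, rmorphM, rmorphXn).
Qed.

Lemma selling_form_hexrot_sum A B C P :
  selling_form A B C P + selling_form A B C (hexrot P) +
    selling_form A B C (hexrot (hexrot P)) =
  (A + B + C) * (2 * (eisenstein_norm P)%:R).
Proof.
rewrite eisenstein_norm_natr; case: P => i j; rewrite /selling_form /hexrot /=.
by rewrite !(rmorphB, rmorphN, opprK) /=; ring.
Qed.

Lemma selling_form_diag A P :
  selling_form A A A P = A * (2 * (eisenstein_norm P)%:R).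
Proof.
by rewrite eisenstein_norm_natr /selling_form rmorphB /=; ring.
Qed.

Lemma selling_form_gt0 A B C P : 0 <= A -> 0 <= B -> 0 <= C ->
  0 < A * B + B * C + C * A -> P != 0 -> 0 < selling_form A B C P.
Proof.
move=> A0 B0 C0 D0 P0; set D := _ + _ in D0.
case: P P0 => i j; rewrite xpair_eqE negb_and => ij.
rewrite /selling_form rmorphB /=.
have : i%:~R != 0 :> R \/ j%:~R != 0 :> R.
  by case/orP: ij => h; [left|right]; rewrite intr_eq0.
set x : R := i%:~R; set y : R := j%:~R => xy.
have nonneg : 0 <= A * (x - y) ^+ 2 + B * y ^+ 2 + C * x ^+ 2.
  by do ?apply: addr_ge0; apply: mulr_ge0 => //; exact: sqr_ge0.
rewrite lt_neqAle nonneg andbT eq_sym; apply/eqP => Q0.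
(* Completing the square in either variable; [D] is the determinant. *)
have Dy : D * y ^+ 2 = 0.
  have : (A + C) * (A * (x - y) ^+ 2 + B * y ^+ 2 + C * x ^+ 2) =
    ((A + C) * x - A * y) ^+ 2 + D * y ^+ 2 by rewrite /D; ring.
  rewrite Q0 mulr0; have := sqr_ge0 ((A + C) * x - A * y).
  by have := mulr_ge0 (ltW D0) (sqr_ge0 y); lra.
have Dx : D * x ^+ 2 = 0.
  have : (A + B) * (A * (x - y) ^+ 2 + B * y ^+ 2 + C * x ^+ 2) =
    ((A + B) * y - A * x) ^+ 2 + D * x ^+ 2 by rewrite /D; ring.
  rewrite Q0 mulr0; have := sqr_ge0 ((A + B) * y - A * x).
  by have := mulr_ge0 (ltW D0) (sqr_ge0 x); lra.
move/eqP: Dx; move/eqP: Dy; rewrite !mulf_eq0 (gt_eqF D0) /= !orbb.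
by case: xy => /negPf ->.
Qed.

End selling_form.

Section power_bounds.
Variable R : realType.
Implicit Types x q : R.

Lemma bernoulli_sub x n : 0 <= x <= 1 -> 1 - x ^+ n <= n%:R * (1 - x).
Proof.
move=> /andP[x0 x1]; elim: n => [|n IH]; first by rewrite expr0 mul0r subrr.
rewrite exprS -natr1.
have : x * (1 - x ^+ n) <= 1 * (n%:R * (1 - x)).
  apply: ler_pM => //; rewrite subr_ge0 exprn_ile1//.
lra.
Qed.

Lemma linear_geometric_decay q d : 0 <= q <= 1 / 4 ->
  (3 + d%:R) * q ^+ d <= 3 * (1 / 2) ^+ d.
Proof.
move=> /andP[q0 q4]; elim: d => [|d IH]; first by rewrite !expr0 addr0.
rewrite !exprS -natr1; have qd : 0 <= q ^+ d by rewrite exprn_ge0.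
have d0 : 0 <= d%:R :> R by [].
have step : (3 + (d%:R + 1)) * q <= 1 / 2 * (3 + d%:R) by nra.
have := ler_wpM2r qd step; lra.
Qed.

End power_bounds.

(** * Near gain and far loss *)

Section energy_comparison.
Variable R : realType.
Variable f : R -> R.
Hypothesis f_gt0 : forall r : R, 0 < r -> 0 < f r.
Hypothesis f_support :
  forall r : R, 0 < r -> exists2 k : R, 0 < k & exp_support f r k.
Variables A B C : R.
Hypotheses (A0 : 0 <= A) (B0 : 0 <= B) (C0 : 0 <= C).
Hypothesis covol : A * B + B * C + C * A = 1.

Let s3 : R := Num.sqrt 3.
Let m0 := s3 / 3.
Let u := A + B + C - s3.
Let q := expR (- (2 * s3)).
Let Q := selling_form A B C.
Let Q0 := selling_form m0 m0 m0.

Let s3_gt0 : 0 < s3. Proof. by rewrite sqrtr_gt0. Qed.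

Lemma excess_ge0 : 0 <= u.
Proof.
have s2 := sqr_sqrt3 R; rewrite -/s3 in s2.
rewrite subr_ge0 -ler_sqr ?nnegrE ?addr_ge0 ?(ltW s3_gt0)//.
rewrite s2; have := sqr_ge0 (A - B); have := sqr_ge0 (B - C).
have := sqr_ge0 (C - A); have := covol; lra.
Qed.

(** The supporting line at the shortest hexagonal squared length reduces the
    claim to [three_exponentials] for the numbers [3 * p - 2 * sqrt 3], with
    [p] the squared lengths [A + C], [A + B], [B + C]; their sum of squares is
    a symmetric function that the area condition expresses through the
    excess. *)
Lemma near_energy_gain k : exp_support f (2 * m0) k -> 0 <= k ->
  2 * (3 * f (2 * m0) + k * (q * (6 / 5 * (u / (2 * s3 + 3 * u))))) <=
  2 * (f (A + C) + f (A + B) + f (B + C)).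
Proof.
move=> kP k0; have s2 := sqr_sqrt3 R; rewrite -/s3 in s2.
have eE (p : R) : expR (- (3 * p)) = q * expR (- (3 * p - 2 * s3)).
  by rewrite /q -expRD; congr expR; ring.
have pos (x y z : R) :
    0 <= x -> 0 <= z -> x * y + y * z + z * x = 1 -> 0 < x + z.
  move=> x0 z0 xyz; rewrite lt_neqAle addr_ge0// andbT; apply/eqP => xz.
  have [x00 z00] : x = 0 /\ z = 0 by split; lra.
  by move: xyz; rewrite x00 z00; lra.
have AC : 0 < A + C by apply: (pos A B C) => //; have := covol; lra.
have AB : 0 < A + B by apply: (pos A C B) => //; have := covol; lra.
have BC : 0 < B + C by apply: (pos B A C) => //; have := covol; lra.
have h1 := kP _ AC; have h2 := kP _ AB; have h3 := kP _ BC.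
have e0 : expR (- (3 * (2 * m0))) = q.
  by rewrite /q; congr expR; rewrite /m0; field.
have := @three_exponentials R (3 * (A + C) - 2 * s3) (3 * (A + B) - 2 * s3)
  (3 * (B + C) - 2 * s3) u excess_ge0; rewrite -/s3 => key.
have sum1 : 3 * (A + C) - 2 * s3 + (3 * (A + B) - 2 * s3) +
  (3 * (B + C) - 2 * s3) = 6 * u by rewrite /u; ring.
have sum2 : (3 * (A + C) - 2 * s3) ^+ 2 + (3 * (A + B) - 2 * s3) ^+ 2 +
  (3 * (B + C) - 2 * s3) ^+ 2 = 6 * u * (2 * s3 + 3 * u).
  rewrite /u; have := covol; move: s2; lra.
have b1 : 3 * (A + C) - 2 * s3 <= s3 + 3 * u by rewrite /u; have := B0; lra.
have b2 : 3 * (A + B) - 2 * s3 <= s3 + 3 * u by rewrite /u; have := C0; lra.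
have b3 : 3 * (B + C) - 2 * s3 <= s3 + 3 * u by rewrite /u; have := A0; lra.
have {}key := key sum1 sum2 b1 b2 b3.
move: h1 h2 h3; rewrite e0 !eE; set E1 := expR _ in key *.
set E2 := expR _ in key *; set E3 := expR _ in key *.
set G := 6 / 5 * _ in key *.
move=> h1 h2 h3.
have := ler_wpM2l (mulr_ge0 k0 (expR_ge0 (- (2 * s3)))) key.
rewrite -/q; lra.
Qed.

(** The slope [k1] of the supporting line at the hexagonal squared length [r]
    is at most [k].  Convexity of the exponential over the orbit of the
    rotation replaces the three squared lengths by their mean, which is larger
    than [r] only through the excess [u]. *)
Lemma far_energy_loss k P : exp_support f (2 * m0) k -> 0 <= k -> far P ->
  3 * f (Q0 P) <= f (Q P) + f (Q (hexrot P)) + f (Q (hexrot (hexrot P))) +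
    3 * (k * (48 * q ^+ 3 * (1 - expR (- u)) * (1 / 2) ^+ taxicab P)).
Proof.
move=> kP k0 Pfar; set n := eisenstein_norm P.
have n3 : 3 <= n%:R :> R by rewrite ler_nat eisenstein_norm_far_ge3.
have m03 : 3 * m0 = s3 by rewrite /m0; field.
have m0_gt0 : 0 < m0 by rewrite divr_gt0.
have rE : Q0 P = m0 * (2 * n%:R) by exact: selling_form_diag.
set r := Q0 P in rE *.
have r0 : 0 < r by rewrite rE; apply: mulr_gt0; lra.
have m0r : 2 * m0 < r by rewrite rE; nra.
have [k1 k10 k1P] := f_support r0.
have k1k : k1 <= k by apply: exp_support_antitone m0r kP k1P; lra.
have Q_gt0 P' : far P' -> 0 < Q P'.
  by case=> P'0 _; apply: selling_form_gt0 => //; rewrite covol.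
have h1 := k1P _ (Q_gt0 _ Pfar).
have h2 := k1P _ (Q_gt0 _ (hexrot_far Pfar)).
have h3 := k1P _ (Q_gt0 _ (hexrot_far (hexrot_far Pfar))).
have := selling_form_hexrot_sum A B C P.
rewrite -/Q -/n; set Q1 := Q P in h1 *; set Q2 := Q (hexrot P) in h2 *.
set Q3 := Q (hexrot (hexrot P)) in h3 * => Qsum.
pose M := 2 * n%:R * (s3 + u).
have ME : 3 * M = 3 * Q1 + 3 * Q2 + 3 * Q3.
  by rewrite -!mulrDr Qsum /M /u; ring.
have tangent p : expR (- M) * (1 + M - p) <= expR (- p).
  have -> : expR (- p) = expR (- M) * expR (M - p).
    by rewrite -expRD; congr expR; ring.
  by rewrite ler_wpM2l ?expR_ge0// -addrA expR_ge1Dx.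
have meanE : 3 * expR (- M) <=
    expR (- (3 * Q1)) + expR (- (3 * Q2)) + expR (- (3 * Q3)).
  have := tangent (3 * Q1); have := tangent (3 * Q2); have := tangent (3 * Q3).
  have : 0 <= expR (- M) by exact: expR_ge0.
  have -> : 3 * Q3 = 3 * M - 3 * Q1 - 3 * Q2 by lra.
  lra.
have E0 : 0 <= expR (- u) by exact: expR_ge0.
have E1 : expR (- u) <= 1 by rewrite -expR0 ler_expR oppr_le0 excess_ge0.
have qrE : expR (- (3 * r)) = q ^+ n.
  by rewrite /q -expRM_natl rE; congr expR; rewrite -m03; ring.
have qME : expR (- M) = q ^+ n * expR (- u) ^+ (2 * n).
  by rewrite /q -!expRM_natl -expRD natrM /M; congr expR; ring.
(* [1 - x ^+ m <= m * (1 - x)] keeps the loss bounded for large [u], unlike the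
   tangent line in [u]. *)
have drop : q ^+ n - expR (- M) <= 2 * n%:R * q ^+ n * (1 - expR (- u)).
  have := @bernoulli_sub R (expR (- u)) (2 * n); rewrite E0 E1 natrM => /(_ isT).
  move/(ler_wpM2l (exprn_ge0 n (expR_ge0 (- (2 * s3))))); rewrite -/q qME; lra.
have drop0 : 0 <= q ^+ n - expR (- M).
  rewrite qME -{1}[q ^+ n]mulr1 -mulrBr mulr_ge0 ?exprn_ge0 ?expR_ge0//.
  by rewrite subr_ge0 exprn_ile1.
(* As [q <= 1 / 4], from [n = 3] on [2 * n * q ^+ n] decays at least like
   [6 * q ^+ 3 * (1 / 2) ^+ (n - 3)], and [48 = 6 * 2 ^+ 3]. *)
have decay : 2 * n%:R * q ^+ n <= 48 * q ^+ 3 * (1 / 2) ^+ taxicab P.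
  have q14 : 0 <= q <= 1 / 4.
    rewrite expR_ge0 /=; apply: le_trans (expRN_2sqrt3_le R) _; lra.
  have := linear_geometric_decay (n - 3) q14.
  have nE : n = (n - 3 + 3)%N by rewrite subnK// eisenstein_norm_far_ge3.
  have wtn : (1 / 2 : R) ^+ n <= (1 / 2) ^+ taxicab P.
    by apply: ler_wiXn2l; [lra|lra|exact: taxicab_le_eisenstein_norm_far].
  have q3 : 0 <= q ^+ 3 by rewrite exprn_ge0 ?expR_ge0.
  have nR : n%:R = 3 + (n - 3)%:R :> R by rewrite {1}nE natrD addrC.
  have half_n : (1 / 2 : R) ^+ n = (1 / 2) ^+ (n - 3) / 8.
    by rewrite {1}nE exprD; field.
  have q_n : q ^+ n = q ^+ (n - 3) * q ^+ 3 by rewrite {1}nE exprD.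
  move=> /(ler_wpM2r q3); rewrite nR q_n.
  have := ler_wpM2l q3 wtn; rewrite half_n; lra.
have loss : k1 * (q ^+ n - expR (- M)) <=
    k * (48 * q ^+ 3 * (1 - expR (- u)) * (1 / 2) ^+ taxicab P).
  apply: ler_pM => //; first exact: ltW.
  apply: le_trans drop _; rewrite [leRHS]mulrAC; apply: ler_wpM2r decay.
  by rewrite subr_ge0.
move: h1 h2 h3; rewrite qrE.
have := ler_wpM2l (ltW k10) meanE; lra.
Qed.

End energy_comparison.

(** * The energy as a function of the Selling parameters *)

Section energy_sums.
Variable R : realType.
Variable f : R -> R.
Hypothesis f_gt0 : forall r : R, 0 < r -> 0 < f r.
Hypothesis f_support :
  forall r : R, 0 < r -> exists2 k : R, 0 < k & exp_support f r k.

Definition selling_energy (A B C : R) : \bar R :=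
  \esum_(P in [set P | P != 0]) (f (selling_form A B C P))%:E.

Let lee_third (x y : \bar R) (l : R) :
  (x + x + x <= y + y + y + (3 * l)%:E -> x <= y + l%:E)%E.
Proof.
case: x y => [x| |] [y| |] //=; rewrite -?EFinD ?leey ?leNye// !lee_fin; lra.
Qed.

Let near_neq0 (P : int * int) : P \in near_vectors -> P != 0.
Proof. by apply: contraTneq => ->. Qed.

Let esumD3 (a b c : int * int -> \bar R) : (forall P, far P -> 0 <= a P)%E ->
  (forall P, far P -> 0 <= b P)%E -> (forall P, far P -> 0 <= c P)%E ->
  (\esum_(P in far) a P + \esum_(P in far) b P + \esum_(P in far) c P =
   \esum_(P in far) (a P + b P + c P))%E.
Proof.
by move=> a0 b0 c0; rewrite -!esumD// => P Pfar; rewrite adde_ge0 ?a0 ?b0.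
Qed.

Let nonzero_split (a : int * int -> R) :
  (forall P : int * int, P != 0 -> 0 <= a P) ->
  \esum_(P in [set P | P != 0]) (a P)%:E =
  ((\sum_(P <- near_vectors) a P)%:E + \esum_(P in far) (a P)%:E)%E.
Proof.
move=> a0; rewrite [LHS](esumID [set` near_vectors]); last first.
  by move=> P P0; rewrite lee_fin a0//.
congr (_ + _)%E; last first.
  congr esum; apply/seteqP; split => P [P0 Pn]; split => //; first exact/negP.
  exact/negP.
have -> : [set P : int * int | P != 0] `&` [set` near_vectors] =
    [set` near_vectors].
  by apply/setIidr => P; exact: near_neq0.
by rewrite esum_seq ?sumEFin// => P /near_neq0 /a0; rewrite lee_fin.
Qed.

(** Summing [far_energy_loss] over all far vectors counts each of them three
    times, because the rotation permutes them. *)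
Lemma selling_energy_gain (A B C : R) : 0 <= A -> 0 <= B -> 0 <= C ->
  A * B + B * C + C * A = 1 ->
  exists2 k, 0 < k &
    let s3 := Num.sqrt 3 in let u := A + B + C - s3 in
    (selling_energy (s3 / 3) (s3 / 3) (s3 / 3) +
      (k * (u / (2 * s3 + 3 * u)))%:E <= selling_energy A B C)%E.
Proof.
move=> A0 B0 C0 covol; set s3 := Num.sqrt 3; set u := A + B + C - s3.
have s30 : 0 < s3 by rewrite sqrtr_gt0.
have m0_gt0 : 0 < s3 / 3 by rewrite divr_gt0.
have u0 : 0 <= u by apply: excess_ge0.
have [|k k0 kP] := @f_support (2 * (s3 / 3)); first by rewrite mulr_gt0.
set q := expR (- (2 * s3)).
exists (k * q / 5); first by rewrite !mulr_gt0 ?expR_gt0 ?invr_gt0.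
have covol0 : 0 < s3 / 3 * (s3 / 3) + s3 / 3 * (s3 / 3) + s3 / 3 * (s3 / 3).
  by have := mulr_gt0 m0_gt0 m0_gt0; lra.
have pos P : P != 0 -> 0 < f (selling_form A B C P).
  by move=> P0; apply/f_gt0/selling_form_gt0; rewrite ?covol.
have pos0 P : P != 0 -> 0 < f (selling_form (s3 / 3) (s3 / 3) (s3 / 3) P).
  by move=> P0; apply/f_gt0/selling_form_gt0 => //; exact: ltW.
rewrite /selling_energy !nonzero_split;
  [|by move=> P /pos/ltW..|by move=> P /pos0/ltW].
set X0 := \esum_(P in far) _; set X := \esum_(P in far) _.
pose loss := k * (264 * q ^+ 3 * (1 - expR (- u))).
have far_le : (X0 <= X + loss%:E)%E.
  have hexrotX : \esum_(P in far) (f (selling_form A B C (hexrot P)))%:E = X.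
    by rewrite /X [RHS](@reindex_esum _ _ _ far far hexrot _ hexrot_bij).
  have hexrot2X :
      \esum_(P in far) (f (selling_form A B C (hexrot (hexrot P))))%:E = X.
    by rewrite -hexrotX [RHS](@reindex_esum _ _ _ far far hexrot _ hexrot_bij).
  have posQ P : far P -> (0 <= (f (selling_form A B C P))%:E)%E.
    by case=> P0 _; rewrite lee_fin ltW// pos.
  have posQ0 P : far P ->
      (0 <= (f (selling_form (s3 / 3) (s3 / 3) (s3 / 3) P))%:E)%E.
    by case=> P0 _; rewrite lee_fin ltW// pos0.
  pose c := k * (48 * q ^+ 3 * (1 - expR (- u))).
  have c0 : 0 <= c.
    rewrite !mulr_ge0 ?(ltW k0) ?exprn_ge0 ?expR_ge0//.
    by rewrite subr_ge0 -expR0 ler_expR oppr_le0.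
  have half0 P : 0 <= (1 / 2 : R) ^+ taxicab P by rewrite exprn_ge0.
  have lossE : (\esum_(P in far) (3 * c * (1 / 2) ^+ taxicab P)%:E <=
      (3 * loss)%:E)%E.
    apply: le_trans (le_esumZl _ _ _) _ => //; first by rewrite mulr_ge0.
    apply: le_trans (lee_wpmul2l _ (esum_halves_far R)) _.
      by rewrite lee_fin mulr_ge0.
    by rewrite -EFinM lee_fin /loss /c; lra.
  apply: lee_third; apply: le_trans (leeD (lexx _) lossE).
    have pos_hexrot P : far P ->
        (0 <= (f (selling_form A B C (hexrot P)))%:E)%E.
      by move=> Pfar; exact/posQ/hexrot_far.
    have pos_hexrot2 P : far P ->
        (0 <= (f (selling_form A B C (hexrot (hexrot P))))%:E)%E.
      by move=> Pfar; exact/pos_hexrot/hexrot_far.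
    rewrite -{2}hexrotX -{1}hexrot2X !esumD3// -esumD; first last.
    - by move=> P _; rewrite lee_fin mulr_ge0// mulr_ge0.
    - by move=> P Pfar; rewrite !adde_ge0 ?pos_hexrot2 ?pos_hexrot ?posQ.
    apply: le_esum => P Pfar; rewrite -!EFinD lee_fin.
    have := far_energy_loss f_support A0 B0 C0 covol kP (ltW k0) Pfar.
    by rewrite -/s3 -/u -/q /c; lra.
have near_le := near_energy_gain A0 B0 C0 covol kP (ltW k0).
have final := near_gain_exceeds_far_loss u0.
have nearE D E F : \sum_(P <- near_vectors) f (selling_form D E F P) =
    2 * (f (D + F) + f (D + E) + f (E + F)).
  have e1 : selling_form D E F (1, 0) = D + F by rewrite /selling_form /=; ring.
  have e2 : selling_form D E F (-1, 0) = D + F by rewrite /selling_form /=; ring.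
  have e3 : selling_form D E F (0, 1) = D + E by rewrite /selling_form /=; ring.
  have e4 : selling_form D E F (0, -1) = D + E by rewrite /selling_form /=; ring.
  have e5 : selling_form D E F (1, 1) = E + F by rewrite /selling_form /=; ring.
  have e6 : selling_form D E F (-1, -1) = E + F by rewrite /selling_form /=; ring.
  by rewrite !big_cons big_nil e1 e2 e3 e4 e5 e6; ring.
rewrite !nearE -/u; set G := (k * q / 5 * _)%R.
apply: le_trans (leeD (leeD (lexx _) far_le) (lexx _)) _.
rewrite -!addeA -!EFinD addeCA [leRHS]addeC; apply: leeD => //.
rewrite -EFinD lee_fin.
have {}final := ler_wpM2l (ltW k0) final.
have two : s3 / 3 + s3 / 3 = 2 * (s3 / 3) by ring.
move: near_le final; rewrite -/s3 -/u -/q /loss /G two; lra.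
Qed.

Lemma selling_energy_hex_fin (K : R) :
  (forall r, 2 * (Num.sqrt 3 / 3) <= r -> f r <= K * expR (- (3 * r))) ->
  (selling_energy (Num.sqrt 3 / 3) (Num.sqrt 3 / 3) (Num.sqrt 3 / 3) < +oo)%E.
Proof.
set s3 := Num.sqrt 3 => fK.
have s30 : 0 < s3 by rewrite sqrtr_gt0.
have m0_gt0 : 0 < s3 / 3 by rewrite divr_gt0.
have K0 : 0 <= K.
  have r0 : 0 < 2 * (s3 / 3) by rewrite mulr_gt0.
  have := lt_le_trans (f_gt0 r0) (fK _ (lexx _)).
  by rewrite pmulr_lgt0 ?expR_gt0// => /ltW.
apply: (@le_lt_trans _ _ (K%:E * 9%:E)%E); last by rewrite -EFinM ltry.
have K0E : (0 <= K%:E)%E by rewrite lee_fin.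
apply: le_trans (lee_wpmul2l K0E (esum_halves_taxicab R)).
apply: (@le_trans _ _ (\esum_(P in [set P : int * int | P != 0])
   (K * (1 / 2) ^+ taxicab P)%:E)).
  apply: le_esum => P P0; rewrite lee_fin selling_form_diag.
  have n1 : 1 <= (eisenstein_norm P)%:R :> R by rewrite ler1n eisenstein_norm_gt0.
  set n := eisenstein_norm P in n1 *.
  apply: le_trans (fK _ _) _; first by nra.
  apply: ler_wpM2l => //.
  have -> : expR (- (3 * (s3 / 3 * (2 * n%:R)))) = expR (- s3) ^+ (2 * n).
    by rewrite -expRM_natl natrM; congr expR; field.
  apply: (@le_trans _ _ ((1 / 2) ^+ (2 * n))).
    have e_half : expR (- s3) <= 1 / 2.
      rewrite expRN -[leLHS]div1r ler_pdivrMr ?expR_gt0//.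
      by have := expR_ge1Dx s3; have := sqrt3_bounds R; rewrite -/s3; lra.
    by apply: lerXn2r => //; rewrite nnegrE ?expR_ge0.
  by apply: ler_wiXn2l; [lra|lra|exact: taxicab_le_2eisenstein_norm].
apply: le_trans (le_esumZl _ _ _) _ => //.
apply: lee_wpmul2l => //.
rewrite [leRHS](esumID [set P : int * int | P != 0]) ?setTI ?leeDl//.
by apply: esum_ge0 => P _; rewrite lee_fin exprn_ge0.
Qed.

End energy_sums.

(** * Plane vectors and integer combinations *)

Section plane_vectors.
Variable R : realType.
Implicit Types (u v w : 'rV[R]_2) (x y : R) (P Q : int * int).

Definition dot u v : R := u 0 0 * v 0 0 + u 0 1 * v 0 1.
Definition cross u v : R := u 0 0 * v 0 1 - u 0 1 * v 0 0.

Lemma rV2P u v : u 0 0 = v 0 0 -> u 0 1 = v 0 1 -> u = v.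
Proof.
move=> h0 h1; apply/rowP => i; case: (unliftP 0 i) => [j ->|->] //.
by rewrite (ord1 j) (_ : lift 0 0 = 1)//; exact: val_inj.
Qed.

Lemma enorm_sqr u : enorm u ^+ 2 = dot u u.
Proof.
rewrite /enorm sqr_sqrtr; last by apply: sumr_ge0 => i _; exact: sqr_ge0.
by rewrite !big_ord_recl big_ord0 addr0 (_ : lift 0 0 = 1)//; exact: val_inj.
Qed.

Lemma enorm_dot u : enorm u = Num.sqrt (dot u u).
Proof. by rewrite -enorm_sqr sqrtr_sqr ger0_norm// sqrtr_ge0. Qed.

Lemma dot_ge0 u : 0 <= dot u u.
Proof. by rewrite addr_ge0// -expr2 sqr_ge0. Qed.

Lemma dot_gt0 u : u != 0 -> 0 < dot u u.
Proof.
move=> u0; rewrite lt_neqAle dot_ge0 andbT eq_sym.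
apply: contraNneq u0; rewrite /dot => uu; apply/eqP.
have : u 0 0 ^+ 2 + u 0 1 ^+ 2 = 0 by rewrite -uu !expr2.
move/eqP; rewrite paddr_eq0 ?sqr_ge0// !sqrf_eq0 => /andP[/eqP h0 /eqP h1].
by apply: rV2P; rewrite mxE.
Qed.

Lemma enorm_eq0 u : (enorm u == 0) = (u == 0).
Proof.
apply/eqP/eqP => [|->]; last first.
  by rewrite enorm_dot /dot !mxE mulr0 addr0 sqrtr0.
move=> u0; apply/eqP; apply: contraT => /dot_gt0.
by rewrite -enorm_sqr u0 expr0n ltxx.
Qed.

Lemma lagrange u v : dot u u * dot v v - dot u v ^+ 2 = cross u v ^+ 2.
Proof. by rewrite /dot /cross; ring. Qed.

Lemma det_cross u v : \det (col_mx u v) = cross u v.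
Proof.
have s1 : fintype.split (lshift 1 0 : 'I_(1 + 1)) = inl 0 := unsplitK (inl 0).
have s2 : fintype.split (rshift 1 0 : 'I_(1 + 1)) = inr 0 := unsplitK (inr 0).
rewrite (expand_det_row _ (lshift 1 0)) !big_ord_recl big_ord0 addr0.
rewrite /cofactor !det_mx11 !mxE s1.
rewrite (_ : lift (lshift 1 0) _ = rshift 1 0); last exact: val_inj.
rewrite s2 /= expr0 expr1.
rewrite (_ : lift ord0 ord0 = 1); last exact: val_inj.
rewrite (_ : lift 1 0 = 0); last exact: val_inj.
by rewrite /cross; ring.
Qed.

Definition combo u v (P : int * int) : 'rV[R]_2 := u *~ P.1 + v *~ P.2.

Lemma comboE u v P i : combo u v P 0 i = P.1%:~R * u 0 i + P.2%:~R * v 0 i.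
Proof.
by rewrite /combo -(scaler_int P.1 u) -(scaler_int P.2 v) !mxE.
Qed.

Lemma int_spanE u v : int_span u v = range (combo u v).
Proof.
apply/seteqP; split => [w [m [n ->]]|w [[m n] _ <-]]; first by exists (m, n).
by exists m, n.
Qed.

Lemma combo_inj u v : cross u v != 0 -> injective (combo u v).
Proof.
move=> uv P Q PQ.
have h0 : combo u v P 0 0 = combo u v Q 0 0 by rewrite PQ.
have h1 : combo u v P 0 1 = combo u v Q 0 1 by rewrite PQ.
move: h0 h1; rewrite !comboE => h0 h1.
set p1 : R := P.1%:~R in h0 h1; set p2 : R := P.2%:~R in h0 h1.
set q1 : R := Q.1%:~R in h0 h1; set q2 : R := Q.2%:~R in h0 h1.
have d0 : (p1 - q1) * u 0 0 + (p2 - q2) * v 0 0 = 0 by lra.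
have d1 : (p1 - q1) * u 0 1 + (p2 - q2) * v 0 1 = 0 by lra.
have e1 : (p1 - q1) * cross u v =
    ((p1 - q1) * u 0 0 + (p2 - q2) * v 0 0) * v 0 1 -
    ((p1 - q1) * u 0 1 + (p2 - q2) * v 0 1) * v 0 0 by rewrite /cross; ring.
have e2 : (p2 - q2) * cross u v =
    ((p1 - q1) * u 0 1 + (p2 - q2) * v 0 1) * u 0 0 -
    ((p1 - q1) * u 0 0 + (p2 - q2) * v 0 0) * u 0 1 by rewrite /cross; ring.
rewrite d0 d1 !mul0r subrr in e1 e2.
have /andP[/eqP P1 /eqP P2] : (P.1 == Q.1) && (P.2 == Q.2).
  move/eqP: e1; move/eqP: e2; rewrite !mulf_eq0 (negPf uv) !orbF !subr_eq0.
  by rewrite !eqr_int => -> ->.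
by rewrite [P]surjective_pairing [Q]surjective_pairing P1 P2.
Qed.

Lemma dot_combo u v P : dot (combo u v P) (combo u v P) =
  selling_form (- dot u v) (dot v v + dot u v) (dot u u + dot u v) P.
Proof.
rewrite /dot !comboE /selling_form rmorphB /=; ring.
Qed.

End plane_vectors.

(** * Reduction to an obtuse superbase *)

Section lattices.
Variable R : realType.
Implicit Types (u v w : 'rV[R]_2) (x y : R) (P Q : int * int).

Lemma combo_combo u v P Q S :
  combo (combo u v P) (combo u v Q) S =
  combo u v (P.1 * S.1 + Q.1 * S.2, P.2 * S.1 + Q.2 * S.2).
Proof.
by apply: rV2P; rewrite !comboE /=; rewrite !(rmorphD, rmorphM) /=; ring.
Qed.

Lemma int_span_subset u v u' v' : int_span u v u' -> int_span u v v' ->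
  int_span u' v' `<=` int_span u v.
Proof.
rewrite !int_spanE => -[P _ <-] [Q _ <-] _ [S _ <-].
by rewrite combo_combo; exists (P.1 * S.1 + Q.1 * S.2, P.2 * S.1 + Q.2 * S.2).
Qed.

Definition unimodular_basis (L : set 'rV[R]_2) u v :=
  L = int_span u v /\ `|cross u v| = 1.

Lemma unimodular_basis_opp L u v : unimodular_basis L u v ->
  unimodular_basis L u (- v).
Proof.
move=> [-> uv]; split; last first.
  by rewrite -uv -[RHS]normrN; congr `|_|; rewrite /cross !mxE; ring.
apply/seteqP; split; apply: int_span_subset.
- by exists 1, 0; rewrite mulr1z mulr0z addr0.
- by exists 0, (- 1); rewrite mulr0z add0r mulrN1z opprK.
- by exists 1, 0; rewrite mulr1z mulr0z addr0.
- by exists 0, (- 1); rewrite mulr0z add0r mulrN1z.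
Qed.

Lemma unimodular_basis_swap L u v : unimodular_basis L u v ->
  unimodular_basis L v u.
Proof.
move=> [-> uv]; split; last first.
  by rewrite -uv -[RHS]normrN; congr `|_|; rewrite /cross; ring.
by apply/seteqP; split => _ [m [n ->]]; exists n, m; rewrite addrC.
Qed.

Lemma unimodular_basis_add L u v : unimodular_basis L u v ->
  unimodular_basis L u (u + v).
Proof.
move=> [-> uv]; split; last first.
  by rewrite -uv; congr `|_|; rewrite /cross !mxE; ring.
apply/seteqP; split; apply: int_span_subset.
- by exists 1, 0; rewrite mulr1z mulr0z addr0.
- by exists (- 1), 1; rewrite mulrN1z mulr1z addKr.
- by exists 1, 0; rewrite mulr1z mulr0z addr0.
- by exists 1, 1; rewrite !mulr1z.
Qed.

Let superbase_size u v := dot u u + dot v v + dot (u + v) (u + v).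

Let superbase_size_ge_dot u v :
  [/\ dot u u <= superbase_size u v & dot v v <= superbase_size u v].
Proof.
by have := dot_ge0 u; have := dot_ge0 v; have := dot_ge0 (u + v);
  rewrite /superbase_size; split; lra.
Qed.

(** By Cramer's rule a coordinate is the area spanned with a basis vector,
    hence at most the product of the two lengths. *)
Lemma coordinate_bound u v P x : `|cross u v| = 1 ->
  dot u u <= x -> dot v v <= x -> dot (combo u v P) (combo u v P) <= x ->
  `|P.1%:~R| <= x /\ `|P.2%:~R| <= x.
Proof.
move=> uv ux vx wx; have x0 := le_trans (dot_ge0 u) ux.
have c2 : cross u v ^+ 2 = 1 by rewrite -(real_normK (num_real _)) uv expr1n.
have le_of_sqr (y : R) : y ^+ 2 <= x ^+ 2 -> `|y| <= x.
  by rewrite -(real_normK (num_real y)) ler_sqr ?nnegrE.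
have area_le w w' : dot w w <= x -> dot w' w' <= x -> cross w w' ^+ 2 <= x ^+ 2.
  move=> wx' w'x; rewrite -lagrange.
  have := ler_pM (dot_ge0 w) (dot_ge0 w') wx' w'x.
  by have := sqr_ge0 (dot w w'); lra.
split; apply: le_of_sqr.
- have -> : P.1%:~R ^+ 2 = P.1%:~R ^+ 2 * cross u v ^+ 2 by rewrite c2 mulr1.
  rewrite -exprMn (_ : _ * _ = cross (combo u v P) v).
    exact: area_le.
  by rewrite /cross !comboE; ring.
- have -> : P.2%:~R ^+ 2 = P.2%:~R ^+ 2 * cross u v ^+ 2 by rewrite c2 mulr1.
  rewrite -exprMn (_ : _ * _ = cross u (combo u v P)).
    exact: area_le.
  by rewrite /cross !comboE; ring.
Qed.

(** A basis minimizing [|u|^2 + |v|^2 + |u + v|^2] works: each of the three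
    inequalities compares it with a neighbouring basis. The minimum exists
    since by [coordinate_bound] only finitely many bases compete with a given
    one; they are encoded by pairs of coordinate pairs in the box [- N, N]. *)
Lemma obtuse_basis_exists L u v : unimodular_basis L u v ->
  exists u' v', [/\ unimodular_basis L u' v', 0 <= - dot u' v',
    0 <= dot v' v' + dot u' v' & 0 <= dot u' u' + dot u' v'].
Proof.
move=> uvL; pose x := superbase_size u v; pose N := (Num.bound x).+1.
have xN : x < N%:R.
  have x0 : 0 <= x.
    by have [h _] := superbase_size_ge_dot u v; exact: le_trans (dot_ge0 u) h.
  by apply: lt_trans (archi_boundP x0) _; rewrite ltr_nat.
pose dec (k : 'I_(2 * N).+1) : int := (k : nat)%:Z - N%:Z.
have decP (m : int) : `|m%:~R| <= x -> exists k, dec k = m.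
  move=> mx; have mN : `|m| < N%:Z.
    rewrite -(ltr_int R) intr_norm; exact: le_lt_trans mx xN.
  have mlt : (absz (m + N%:Z)%R < (2 * N).+1)%N by lia.
  by exists (Ordinal mlt); rewrite /dec /=; lia.
pose vec (k : 'I_(2 * N).+1 * 'I_(2 * N).+1) := combo u v (dec k.1, dec k.2).
pose good
    (t : ('I_(2 * N).+1 * 'I_(2 * N).+1) * ('I_(2 * N).+1 * 'I_(2 * N).+1)) :=
  `[< unimodular_basis L (vec t.1) (vec t.2) >].
have enc u' v' : unimodular_basis L u' v' -> superbase_size u' v' <= x ->
    exists2 t, good t & vec t.1 = u' /\ vec t.2 = v'.
  move=> L' le_x; have [u'x v'x] := superbase_size_ge_dot u' v'.
  have [ux vx] := superbase_size_ge_dot u v.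
  have vecP w : int_span u v w -> dot w w <= x -> exists k, vec k = w.
    rewrite int_spanE => -[P _ <-] wx.
    have [] := coordinate_bound (proj2 uvL) ux vx wx.
    move=> /decP[k1 k1P] /decP[k2 k2P]; exists (k1, k2).
    by rewrite /vec /= k1P k2P -surjective_pairing.
  have sub w : int_span u' v' w -> int_span u v w.
    by rewrite -(proj1 L') -(proj1 uvL).
  have [k1 k1P] : exists k, vec k = u'.
    apply: vecP (le_trans u'x le_x); apply: sub.
    by exists 1, 0; rewrite mulr1z mulr0z addr0.
  have [k2 k2P] : exists k, vec k = v'.
    apply: vecP (le_trans v'x le_x); apply: sub.
    by exists 0, 1; rewrite mulr0z add0r mulr1z.
  by exists (k1, k2); rewrite /good /= ?k1P ?k2P //; apply/asboolP.
have [t0 good0 [t01 t02]] := enc _ _ uvL (lexx _).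
pose F t := superbase_size (vec t.1) (vec t.2).
case: (@Order.TotalTheory.arg_minP _ _ _ t0 good F good0) => t /asboolP tL tmin.
have {}tmin u' v' : unimodular_basis L u' v' -> F t <= superbase_size u' v'.
  move=> L'; have [le_x|lt_x] := leP (superbase_size u' v') x.
    by have [t' good' [<- <-]] := enc _ _ L' le_x; exact: tmin.
  by apply: le_trans (ltW lt_x); rewrite /x -t01 -t02; exact: tmin.
exists (vec t.1), (vec t.2); split => //.
- have := tmin _ _ (unimodular_basis_opp tL).
  rewrite /F /superbase_size /dot !mxE; lra.
- have := tmin _ _ (unimodular_basis_add (unimodular_basis_swap tL)).
  rewrite /F /superbase_size /dot !mxE; lra.
- have := tmin _ _ (unimodular_basis_add tL).
  rewrite /F /superbase_size /dot !mxE; lra.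
Qed.

End lattices.

(** * Energies of lattices and isometries *)

Section lattice_energies.
Variable R : realType.
Implicit Types (u v w : 'rV[R]_2) (f : R -> R) (L : set 'rV[R]_2).

Lemma lattice_of_area1P L :
  lattice_of_area 1 L <-> exists u v, unimodular_basis L u v.
Proof.
split => [[u [v [_]]]|[u [v [-> uv]]]].
  by rewrite det_cross => uv ->; exists u, v.
exists u, v; rewrite det_cross uv; split => //.
by rewrite -normr_eq0 uv oner_eq0.
Qed.

Lemma lattice_energy_pos f L : (forall r : R, 0 < r -> 0 < f r) ->
  lattice_energy f L = \esum_(P in L `\ (0 : 'rV[R]_2)) (f (enorm P ^+ 2))%:E.
Proof.
move=> f0; have fP P : (L `\ (0 : 'rV[R]_2)) P -> 0 < f (enorm P ^+ 2).
  by case=> _ /eqP P0; rewrite f0// enorm_sqr dot_gt0.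
rewrite /lattice_energy [X in (_ - X)%E]esum1 ?sube0 => [|P /fP fPP].
  by apply: eq_esum => P /fP/ltW fPP; rewrite max_l.
by rewrite max_r// oppr_le0 ltW.
Qed.

Lemma lattice_energy_selling f L u v : (forall r : R, 0 < r -> 0 < f r) ->
  unimodular_basis L u v ->
  lattice_energy f L =
  selling_energy f (- dot u v) (dot v v + dot u v) (dot u u + dot u v).
Proof.
move=> f0 [LE uv]; rewrite lattice_energy_pos// LE int_spanE.
have uv0 : cross u v != 0 by rewrite -normr_eq0 uv oner_eq0.
have c0 : combo u v 0 = 0 by apply: rV2P; rewrite comboE !mxE !mul0r addr0.
rewrite (@reindex_esum _ _ _ [set P | P != 0] _ (combo u v)).
  by apply: eq_esum => P _; rewrite enorm_sqr dot_combo.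
split => [P /= P0|P Q _ _|w [[P _ <-] /= w0]].
- split; first by exists P.
  by move=> /= h; move/eqP: P0; apply; apply: (combo_inj uv0); rewrite c0.
- exact: combo_inj.
- by exists P => //=; apply: contra_notN w0 => /eqP ->.
Qed.

Lemma covolume u v : `|cross u v| = 1 ->
  - dot u v * (dot v v + dot u v) +
  (dot v v + dot u v) * (dot u u + dot u v) +
  (dot u u + dot u v) * (- dot u v) = 1.
Proof.
move=> uv; have := lagrange u v.
rewrite -(real_normK (num_real (cross u v))) uv expr1n; lra.
Qed.

(** The isometry [T] may move the origin and need not be linear; after
    subtracting [T 0], which lies in [L'], it is an injection preserving
    lengths. *)
Lemma lattice_energy_isometric f L L' : (forall r : R, 0 < r -> 0 < f r) ->
  lattice_of_area 1 L -> lattice_of_area 1 L' -> isometric L L' ->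
  lattice_energy f L = lattice_energy f L'.
Proof.
move=> f0 [u [v [_ _ LE]]] [u' [v' [_ _ L'E]]] [T [Tiso TL]].
have L0 : L 0 by rewrite LE; exists 0, 0; rewrite !mulr0z addr0.
have L'sub P Q : L' P -> L' Q -> L' (P - Q).
  rewrite L'E => -[m [n ->]] [m' [n' ->]]; exists (m - m'), (n - n').
  by rewrite !mulrzBr opprD addrACA.
have L'add P Q : L' P -> L' Q -> L' (P + Q).
  rewrite L'E => -[m [n ->]] [m' [n' ->]]; exists (m + m'), (n + n').
  by rewrite !mulrzDr addrACA.
have TL' P : L P -> L' (T P) by move=> LP; rewrite -TL; exists P.
rewrite !lattice_energy_pos//.
rewrite [RHS](@reindex_esum _ _ _ (L `\ (0 : 'rV[R]_2)) _ (fun P => T P - T 0)).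
  by apply: eq_esum => P _; rewrite Tiso subr0.
have T_eq P Q : T P = T Q -> P = Q.
  move=> PQ; apply/eqP; rewrite -subr_eq0 -enorm_eq0 -Tiso PQ subrr.
  by rewrite enorm_eq0.
split => [P [LP P0]|P Q _ _ /addIr/T_eq//|P [L'P P0]].
  split; first exact: L'sub (TL' _ LP) (TL' _ L0).
  by move=> /= /eqP; rewrite subr_eq0 => /eqP /T_eq.
have : L' (P + T 0) by apply: L'add => //; exact: TL'.
rewrite -TL => -[Q LQ QE]; exists Q; last by rewrite QE addrK.
split=> // /= Q0; apply: P0 => /=; move: QE; rewrite Q0.
by rewrite -[LHS]add0r => /addIr.
Qed.

(** The linear map sending one basis to the other, in Cramer coordinates. *)
Lemma isometric_of_gram L L' u v u' v' :
  unimodular_basis L u v -> unimodular_basis L' u' v' ->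
  dot u u = dot u' u' -> dot v v = dot v' v' -> dot u v = dot u' v' ->
  isometric L L'.
Proof.
move=> [-> uv] [-> _] uu vv uvE.
have uv0 : cross u v != 0 by rewrite -normr_eq0 uv oner_eq0.
pose T w := (cross w v / cross u v) *: u' + (cross u w / cross u v) *: v'.
have decomp w : w = (cross w v / cross u v) *: u + (cross u w / cross u v) *: v.
  by apply: rV2P; rewrite !mxE; rewrite /cross in uv0 *; field.
exists T; split => [P Q|].
  rewrite !enorm_dot; congr Num.sqrt.
  have -> : T P - T Q = T (P - Q).
    by apply: rV2P; rewrite /T /cross !mxE; ring.
  have dotT w x y : w = x *: u + y *: v -> dot w w =
      dot (x *: u' + y *: v') (x *: u' + y *: v').
    move=> ->; transitivity
      (x ^+ 2 * dot u u + 2 * x * y * dot u v + y ^+ 2 * dot v v).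
      by rewrite /dot !mxE; ring.
    by rewrite uu vv uvE /dot !mxE; ring.
  by rewrite [RHS](dotT _ _ _ (decomp _)).
have TE P : T (combo u v P) = combo u' v' P.
  apply: rV2P; rewrite [RHS]comboE /T mxE mxE [in X in _ + X]mxE /cross !comboE;
    rewrite /cross in uv0; field; exact: uv0.
rewrite !int_spanE; apply/seteqP; split => [_ [_ [P _ <-] <-]|_ [P _ <-]].
  by exists P.
by exists (combo u v P) => //; exists P.
Qed.

End lattice_energies.

(** * The hexagonal lattice *)

Section hexagonal.
Variable R : realType.

Let s3 : R := Num.sqrt 3.
Let c : R := Num.sqrt (2 / s3).
Let h1 : 'rV[R]_2 := c *: vec2 1 0.
(* The second vector of the usual basis minus the first: an obtuse basis. *)
Let h2 : 'rV[R]_2 := c *: vec2 (- (1 / 2)) (s3 / 2).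

Let vec2_0 (x y : R) : vec2 x y 0 0 = x. Proof. by rewrite mxE. Qed.
Let vec2_1 (x y : R) : vec2 x y 0 1 = y. Proof. by rewrite mxE. Qed.
Let scale_vec2_0 (x y : R) : (c *: vec2 x y) 0 0 = c * x.
Proof. by rewrite mxE vec2_0. Qed.
Let scale_vec2_1 (x y : R) : (c *: vec2 x y) 0 1 = c * y.
Proof. by rewrite mxE vec2_1. Qed.

Let s3_gt0 : 0 < s3. Proof. by rewrite sqrtr_gt0. Qed.

Let c_sqr : c ^+ 2 = 2 * (s3 / 3).
Proof.
rewrite sqr_sqrtr ?divr_ge0 ?ltW//; have := sqr_sqrt3 R; rewrite -/s3 => s2.
by apply: (mulIf (lt0r_neq0 s3_gt0)); rewrite divfK ?lt0r_neq0//; lra.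
Qed.

Lemma hexagonal_gram : [/\ dot h1 h1 = 2 * (s3 / 3), dot h2 h2 = 2 * (s3 / 3) &
  dot h1 h2 = - (s3 / 3)].
Proof.
have s2 := sqr_sqrt3 R; rewrite -/s3 in s2.
have expand (x y x' y' : R) : dot (c *: vec2 x y) (c *: vec2 x' y') =
    c ^+ 2 * (x * x' + y * y') by rewrite /dot !scale_vec2_0 !scale_vec2_1; ring.
rewrite !expand c_sqr; split; [by ring| |by field].
have -> : - (1 / 2) * - (1 / 2) + s3 / 2 * (s3 / 2) = 1 / 4 + s3 ^+ 2 / 4 by field.
by rewrite s2; field.
Qed.

Lemma hexagonal_basis : unimodular_basis (hexagonal_lattice R) h1 h2.
Proof.
split; last first.
  have -> : cross h1 h2 = c ^+ 2 * (s3 / 2).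
    by rewrite /cross !scale_vec2_0 !scale_vec2_1; ring.
  rewrite c_sqr; have := sqr_sqrt3 R; rewrite -/s3 => s2.
  have -> : 2 * (s3 / 3) * (s3 / 2) = s3 ^+ 2 / 3 by field.
  by rewrite s2 divff ?normr1.
have h2E : h2 = c *: vec2 (1 / 2) (s3 / 2) - h1.
  have subE (v w : 'rV[R]_2) i : (v - w) 0 i = v 0 i - w 0 i by rewrite !mxE.
  apply: rV2P; rewrite /h2 /h1 subE; first by rewrite !scale_vec2_0; field.
  by rewrite !scale_vec2_1; field.
apply/seteqP; split => [_ [_ [m [n ->]] <-]|_ [m [n ->]]].
  exists (m + n), n; rewrite h2E mulrzDr mulrzBl addrAC addrA subrK.
  by rewrite -/s3 -/c scalerDr -!scalerMzr.
exists (vec2 1 0 *~ (m - n) + vec2 (1 / 2) (s3 / 2) *~ n).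
  by exists (m - n), n.
rewrite -/s3 -/c h2E mulrzBl scalerDr -!scalerMzr mulrzBr.
by rewrite addrA addrAC.
Qed.

End hexagonal.

(** * Minimality of the hexagonal lattice *)

(** If the energy is minimal, the gain of [selling_energy_gain] vanishes, as the
    hexagonal energy is finite; so [A + B + C = sqrt 3], which together with the
    area condition forces [A = B = C], and the Gram matrices agree. *)
Lemma hexagonal_minimality (R : realType) (f : R -> R) (K : R)
    (L : set 'rV[R]_2) :
  (forall r : R, 0 < r -> 0 < f r) ->
  (forall r : R, 0 < r -> exists2 k : R, 0 < k & exp_support f r k) ->
  (forall r, 2 * (Num.sqrt 3 / 3) <= r -> f r <= K * expR (- (3 * r))) ->
  lattice_of_area 1 L ->
  (lattice_energy f (hexagonal_lattice R) <= lattice_energy f L)%E /\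
  ((lattice_energy f L <= lattice_energy f (hexagonal_lattice R))%E ->
   isometric L (hexagonal_lattice R)).
Proof.
move=> f0 fsup fK /lattice_of_area1P[u0 [v0 /obtuse_basis_exists]].
move=> [u [v [uvL A0 B0 C0]]].
have hexL := hexagonal_basis R; have [h11 h22 h12] := hexagonal_gram R.
have fin := selling_energy_hex_fin f0 fK.
set s3 := Num.sqrt 3 in h11 h22 h12 fin hexL.
have third : 2 * (s3 / 3) + - (s3 / 3) = s3 / 3 by field.
rewrite (lattice_energy_selling f0 uvL) (lattice_energy_selling f0 hexL).
rewrite h11 h22 h12 third opprK.
have covol := covolume (proj2 uvL).
have [k k0] := selling_energy_gain f0 fsup A0 B0 C0 covol.
rewrite /= -/s3; set x := (_ - s3)%R; set E0 := selling_energy f _ _ _ in fin *.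
set E := selling_energy f _ _ _ => gain.
have x0 : 0 <= x by apply: excess_ge0.
have s30 : 0 < s3 by rewrite sqrtr_gt0.
have w0 : 0 < 2 * s3 + 3 * x by rewrite ltr_pwDl ?mulr_gt0 ?mulr_ge0.
split.
  apply: le_trans gain; rewrite leeDl// lee_fin mulr_ge0 ?(ltW k0)//.
  by rewrite divr_ge0// ltW.
move=> EE0; have := le_trans gain EE0.
have E0fin : E0 \is a fin_num.
  rewrite ge0_fin_numE //; apply: esum_ge0 => P P0; rewrite lee_fin.
  have s90 : 0 < s3 / 3 by rewrite divr_gt0.
  apply/ltW/f0/selling_form_gt0 => //; try exact: ltW.
  by have := mulr_gt0 s90 s90; lra.
rewrite -[leRHS]adde0 leeD2lE// lee_fin pmulr_rle0// pmulr_lle0 ?invr_gt0//.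
move=> x_le0.
have xE : x = 0 by apply/eqP; rewrite eq_le x_le0.
have s2 := sqr_sqrt3 R; rewrite -/s3 in s2.
have [AB BC] : - dot u v = s3 / 3 /\ dot v v + dot u v = s3 / 3.
  move: xE covol; rewrite /x.
  move: (- dot u v) (dot v v + dot u v) (dot u u + dot u v) => A B C xE covol.
  have CE : C = s3 - A - B by lra.
  (* four times the equality [A B + B C + C A = 1], as a sum of squares *)
  have : (2 * B - (s3 - A)) ^+ 2 + 3 * (A - s3 / 3) ^+ 2 = 0.
    by move: covol; rewrite CE; lra.
  move/eqP; rewrite paddr_eq0; [|exact: sqr_ge0|by rewrite mulr_ge0 ?sqr_ge0].
  rewrite sqrf_eq0 mulf_eq0 pnatr_eq0 sqrf_eq0 /= !subr_eq0.
  move=> /andP[/eqP h1 /eqP h2].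
  by split; lra.
apply: (isometric_of_gram uvL hexL); rewrite ?h11 ?h22 ?h12.
- by move: xE; rewrite /x; lra.
- by lra.
- by lra.
Qed.

Unset Implicit Arguments.

Theorem corollary1p3 (R : realType) (alpha a b : R)
    (halpha : 1 <= alpha) (ha : 1 < a) (hb : b <= 1 / Num.sqrt a) :
  (exists L : set 'rV[R]_2, energy_minimizer (yukawa_diff alpha a b) 1 L) /\
  (forall L : set 'rV[R]_2, lattice_of_area 1 L ->
     (energy_minimizer (yukawa_diff alpha a b) 1 L <->
      isometric L (hexagonal_lattice R))).
Proof.
pose f := yukawa_diff alpha a b.
have f0 : forall r : R, 0 < r -> 0 < f r by exact: yukawa_gt0.
have fsup : forall r : R, 0 < r -> exists2 k : R, 0 < k & exp_support f r k.
  exact: yukawa_exp_support.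
have r0 : 0 < 2 * (Num.sqrt 3 / 3) :> R.
  by rewrite mulr_gt0// divr_gt0// sqrtr_gt0.
have minL L := @hexagonal_minimality R f _ L f0 fsup
  (fun r => @yukawa_le_exp R alpha a b halpha ha hb _ r r0).
have hexL : lattice_of_area 1 (hexagonal_lattice R).
  by apply/lattice_of_area1P; do 2 eexists; exact: hexagonal_basis.
have hex_min : energy_minimizer f 1 (hexagonal_lattice R).
  by split=> // L /minL[].
split; first by exists (hexagonal_lattice R).
move=> L areaL; split => [[_ /(_ _ hexL)]|iso].
  by have [_] := minL L areaL; apply.
split=> // L' /(proj2 hex_min).
by rewrite (lattice_energy_isometric f0 areaL hexL iso).
Qed.
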